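(* Let $\theta<\kappa$ be a pair of infinite regular cardinals. The following are equivalent: (1) $\boxminus^{\mathrm{ind}}(\kappa,\theta)$ holds; (2) there is a closed, subadditive witness to $\mathrm{U}(\kappa,2,\theta,2)$; (3) there is a closed, subadditive witness to $\mathrm{U}(\kappa,\kappa,\theta,\sup(\mathrm{Reg}(\kappa)))$. In addition, $\square(\kappa,\sqsubseteq_\theta)$ implies (1)--(3).
   Context: $\mathrm{Reg}(\kappa)$ is the set of infinite regular cardinals below $\kappa$; $E^\kappa_{\neq\theta}=\{\alpha<\kappa\mid \mathrm{cf}(\alpha)\neq\theta\}$. For a set $a$ of ordinals: $\mathrm{ssup}(a)=\sup\{\alpha+1\mid\alpha\in a\}$, $\mathrm{acc}^+(a)=\{\alpha<\mathrm{ssup}(a)\mid \sup(a\cap\alpha)=\alpha>0\}$, $\mathrm{acc}(a)=a\cap\mathrm{acc}^+(a)$, $\mathrm{nacc}(a)=a\setminus\mathrm{acc}(a)$. For sets of ordinals, $a<b$ means every element of $a$ is below every element of $b$. For a coloring $c:[\kappa]^2\to\theta$ we write $c(\alpha,\beta)$ for $c(\{\alpha,\beta\})$ with $\alpha<\beta$. $\mathrm{U}(\kappa,\mu,\theta,\chi)$: a coloring $c:[\kappa]^2\to\theta$ witnesses it if for every $\sigma<\chi$, every pairwise disjoint $\mathcal A\subseteq[\kappa]^\sigma$ with $|\mathcal A|=\kappa$, and every $i<\theta$, there is $\mathcal B\subseteq\mathcal A$ with $|\mathcal B|=\mu$ such that $\min(c[a\times b])>i$ for all $a,b\in\mathcal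 B$ with $a<b$. $c$ is subadditive if for all $\alpha<\beta<\gamma<\kappa$: $c(\alpha,\gamma)\le\max\{c(\alpha,\beta),c(\beta,\gamma)\}$ and $c(\alpha,\beta)\le\max\{c(\alpha,\gamma),c(\beta,\gamma)\}$. $D^c_{\le i}(\beta)=\{\alpha<\beta\mid c(\alpha,\beta)\le i\}$. $c$ is closed if $\mathrm{acc}^+(D^c_{\le i}(\beta))\subseteq D^c_{\le i}(\beta)$ for all $\beta<\kappa$ and $i\le\theta$. $\boxminus^{\mathrm{ind}}(\kappa,\theta)$ asserts the existence of a matrix $\langle C_{\alpha,i}\mid\alpha\in\Gamma,\ i(\alpha)\le i<\theta\rangle$ such that: (i) $E^\kappa_{\ne\theta}\cap\mathrm{acc}(\kappa)\subseteq\Gamma\subseteq\mathrm{acc}(\kappa)$; (ii) for all $\alpha\in\Gamma$, $i(\alpha)<\theta$, and $\langle C_{\alpha,i}\mid i(\alpha)\le i<\theta\rangle$ is a $\subseteq$-increasing sequence of clubs in $\alpha$ with $\Gamma\cap\alpha=\bigcup_{i(\alpha)\le i<\theta}\mathrm{acc}(C_{\alpha,i})$; (iii) for all $\alpha\in\Gamma$, $i(\alpha)\le i<\theta$ and $\bar\alpha\in\mathrm{acc}(C_{\alpha,i})$, we have $i(\bar\alpha)\le i$ and $C_{\bar\alpha,i}=C_{\alpha,i}\cap\bar\alpha$; (iv) for every club $D\subseteq\kappa$ there is $\alpha\in\mathrm{acc}(D)\cap\Gamma$ such that $D\cap\alpha\ne C_{\alpha,i}$ for all $i\in[i(\alpha),\theta)$.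 A $C$-sequence over $\kappa$ is a sequence $\langle C_\beta\mid\beta<\kappa\rangle$ where each $C_\beta$ is a closed subset of $\beta$ with $\sup(C_\beta)=\sup(\beta)$. For sets of ordinals, $D\sqsubseteq C$ means $D=C\cap\beta$ for some ordinal $\beta$; $D\sqsubseteq_\theta C$ means that either $D\sqsubseteq C$, or $\mathrm{otp}(C)<\theta$ and $\mathrm{nacc}(C)$ consists only of successor ordinals. $\square(\kappa,\sqsubseteq_\theta)$ asserts the existence of a $C$-sequence $\langle C_\beta\mid\beta<\kappa\rangle$ such that $C_{\bar\beta}\sqsubseteq_\theta C_\beta$ for all limit $\beta<\kappa$ and $\bar\beta\in\mathrm{acc}(C_\beta)$, and for every club $D\subseteq\kappa$ there is $\alpha\in\mathrm{acc}(D)$ with $D\cap\alpha\ne C_\alpha$. *)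

(* Defs.v *)
From mathcomp Require Import all_boot all_order.
From mathcomp Require Import boolp classical_sets functions cardinality.
Set Implicit Arguments.
Unset Strict Implicit.
Unset Printing Implicit Defensive.
Import Order.TTheory.
Local Open Scope order_scope.
Local Open Scope classical_set_scope.
Local Open Scope card_scope.

(* Ordinals are the elements of an arbitrary well-ordered type [O] with least
   element [\bot] = 0; an ordinal [a] is identified, when used as a set, with
   [below a].  The notions below are absolute: on the ordinals [<= kappa] they
   do not depend on what [O] contains above [kappa].  Well-foundedness of [<]
   is a hypothesis of the theorem, not of these definitions. *)

Section Ordinals.
Context {d : Order.disp_t} {O : bOrderType d}.
Implicit Types (a b A C D : set O) (i mu sigma theta chi kappa : O).

Definition well_ordered : Prop := well_founded (fun x y : O => x < y).

Definition below alpha : set O := [set x | x < alpha].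

(* [osup] and [omin] return 0 on the empty set. *)
Definition osup a : O := supremum \bot a.
Definition omin a : O := infimum \bot a.

(* Meaningful unless [alpha] is the last element of [O]. *)
Definition succ alpha : O := omin [set x | alpha < x].

Definition is_succ alpha : Prop := exists2 beta, beta < alpha & alpha = succ beta.
Definition is_limit alpha : Prop := \bot < alpha /\ ~ is_succ alpha.

Definition ssup a : O := osup [set succ x | x in a].
Definition accp a : set O :=
  [set alpha | alpha < ssup a /\ osup (a `&` below alpha) = alpha /\ \bot < alpha].
Definition acc a : set O := a `&` accp a.
Definition nacc a : set O := a `\` acc a.

Definition cofinal_in a alpha : Prop :=
  a `<=` below alpha /\ forall x, x < alpha -> exists2 y, a y & x <= y.
(* Among the ordinals equinumerous with cofinal subsets of [alpha], the least
   one is automatically a cardinal. *)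
Definition cf alpha : O :=
  omin [set beta | exists2 a, cofinal_in a alpha & a #= below beta].
(* [cf kappa = kappa] forces [kappa] to be an initial ordinal. *)
Definition infinite_regular kappa : Prop :=
  infinite_set (below kappa) /\ cf kappa = kappa.
Definition Reg kappa : set O := [set mu | mu < kappa /\ infinite_regular mu].

Definition otp a : O :=
  xget \bot [set tau | exists f : O -> O, set_bij (below tau) a f /\
                         forall x y, x < y -> y < tau -> f x < f y].

Definition closed_in C alpha : Prop :=
  C `<=` below alpha /\
  forall gamma, gamma < alpha -> \bot < gamma ->
    osup (C `&` below gamma) = gamma -> C gamma.
(* Used for nonzero limit [alpha]. *)
Definition club C alpha : Prop := closed_in C alpha /\ osup C = alpha.

Definition set_lt a b : Prop := forall x y, a x -> b y -> x < y.

(* A coloring of [kappa]^2 is a binary function of which only the values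
   [c alpha beta] with [alpha < beta < kappa] are relevant. *)
Definition coloring kappa theta (c : O -> O -> O) : Prop :=
  forall alpha beta, alpha < beta -> beta < kappa -> c alpha beta < theta.

Definition witnesses_U kappa mu theta chi (c : O -> O -> O) : Prop :=
  coloring kappa theta c /\
  forall sigma, sigma < chi ->
  forall AA : set (set O),
    (forall a, AA a -> a `<=` below kappa /\ a #= below sigma) ->
    trivIset AA id ->
    AA #= below kappa ->
  forall i, i < theta ->
  exists BB : set (set O), [/\ BB `<=` AA, BB #= below mu &
    forall a b, BB a -> BB b -> set_lt a b ->
      i < omin [set c x y | x in a & y in b]].

Definition subadditive kappa (c : O -> O -> O) : Prop :=
  forall alpha beta gamma, alpha < beta -> beta < gamma -> gamma < kappa ->
    c alpha gamma <= Order.max (c alpha beta) (c beta gamma) /\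
    c alpha beta <= Order.max (c alpha gamma) (c beta gamma).

Definition Dle (c : O -> O -> O) i beta : set O :=
  [set alpha | alpha < beta /\ c alpha beta <= i].

Definition closed_coloring kappa theta (c : O -> O -> O) : Prop :=
  forall beta i, beta < kappa -> i <= theta ->
    accp (Dle c i beta) `<=` Dle c i beta.

(* The matrix is given by total functions [iota] and [C]; only
   [iota alpha] and [C alpha i] with [alpha] in [Gamma] and
   [iota alpha <= i < theta] are relevant. *)
Definition boxminus_ind kappa theta : Prop :=
  exists (Gamma : set O) (iota : O -> O) (C : O -> O -> set O),
  [/\ [set alpha | alpha < kappa /\ cf alpha <> theta] `&` acc (below kappa)
        `<=` Gamma /\ Gamma `<=` acc (below kappa),
      forall alpha, Gamma alpha ->
        [/\ iota alpha < theta,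
            forall i, iota alpha <= i -> i < theta -> club (C alpha i) alpha,
            forall i j, iota alpha <= i -> i <= j -> j < theta ->
              C alpha i `<=` C alpha j &
            Gamma `&` below alpha =
              \bigcup_(i in [set i | iota alpha <= i /\ i < theta])
                 acc (C alpha i)],
      forall alpha i alpha', Gamma alpha -> iota alpha <= i -> i < theta ->
        acc (C alpha i) alpha' ->
        iota alpha' <= i /\ C alpha' i = C alpha i `&` below alpha' &
      forall D, club D kappa ->
        exists2 alpha, (acc D `&` Gamma) alpha &
          forall i, iota alpha <= i -> i < theta ->
            D `&` below alpha <> C alpha i].

Definition C_sequence kappa (C : O -> set O) : Prop :=
  forall beta, beta < kappa ->
    closed_in (C beta) beta /\ osup (C beta) = osup (below beta).

Definition init_seg D C : Prop := exists beta, D = C `&` below beta.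
Definition init_seg_mod theta D C : Prop :=
  init_seg D C \/ otp C < theta /\ nacc C `<=` is_succ.

Definition square kappa theta : Prop :=
  exists C : O -> set O,
  [/\ C_sequence kappa C,
      forall beta beta', beta < kappa -> is_limit beta ->
        acc (C beta) beta' -> init_seg_mod theta (C beta') (C beta) &
      forall D, club D kappa ->
        exists2 alpha, acc D alpha & D `&` below alpha <> C alpha].

End Ordinals.

Arguments well_ordered {d} O.

(* Main.v *)
Require Import Defs.
From mathcomp Require Import all_boot all_order.
From mathcomp Require Import boolp classical_sets functions cardinality.
Set Implicit Arguments.
Unset Strict Implicit.
Unset Printing Implicit Defensive.
Import Order.TTheory.
Local Open Scope order_scope.
Local Open Scope classical_set_scope.
Local Open Scope card_scope.

(** A coloring [c] and the relations [c alpha beta <= i], increasing in [i],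
    carry the same information.  Subadditivity says that each of these relations
    is a tree ordering contained in [<], and closedness that its initial branches
    [Dle c i beta] are closed; so a matrix of coherent clubs and a closed
    subadditive coloring are two descriptions of one object, with
    [acc (C beta i)] in the role of [Dle c i beta].  A thread through the matrix,
    that is, a club [D] such that each [D `&` below alpha] is some [C alpha i],
    corresponds to an unbounded set on which [c] is bounded below [theta].

    The closedness of the statement speaks only of limit points of
    [Dle c i beta] below its supremum.  The arguments therefore pivot on the
    predicate [strong], in which the supremum is included as well, and run in a
    circle: a matrix or a square sequence yields a strong coloring, a strong
    coloring witnesses the large form of U, which contains the small form, and
    any closed subadditive witness to the small form yields a matrix.

    - From a matrix on [Gamma] ([boxminus_strong]): each ordinal is sent to the
      next member of [Gamma], and the relation at level [i] is read off
      [acc (C beta i)].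
    - From a strong coloring to the large form of U ([strong_witnesses_U]): given
      sets of size [sigma], let [mu > sigma] be regular and attach to each
      [delta] of cofinality [mu] a set [a] of the family above [delta].  By
      closedness [Dle c i beta], for [beta] in [a], is bounded below [delta]
      unless [c delta beta <= i].  There are fewer than [mu] of these bounds, and
      pressing down makes their supremum constant on many [delta]; on those,
      either all the values are large, or [c] is bounded by [i].
    - From a coloring to a matrix ([boxminus_of_coloring]): [Gamma] is the set of
      all [alpha] in which some [Dle c i alpha] is cofinal, which is so whenever
      [cf alpha] is not [theta].  This works as long as [Gamma] meets every club,
      and it can fail only if [theta] is the unique regular cardinal below
      [kappa], that is, for [theta = omega] and [kappa = omega_1].  There one
      starts afresh from walks along ladders of order type [omega]; if the
      resulting coloring fails as well, then its sets [Dle c i alpha] meet some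
      club in finite sets, and a matrix is obtained by filling these in with
      ladders ([single_boxminus]).
    - From a square sequence ([square_strong]): the relations are defined along
      walks on the C-sequence, in the style of Todorcevic's rho functions
      ([walk]).  Coherence makes them subadditive ([walk_subadditive]) and closed
      ([walk_limit]) whatever the weights [M] carried by the ordinals, provided
      that [M] does not decrease along the coherent branches.  If the C-sequence
      has no thread, then at some level its initial segments are so diverse that
      such a weight exists which takes large values on stationary sets
      ([many_traces_strong]); otherwise the tree of initial segments is narrow,
      and a cofinal branch is a thread ([few_traces_thread]). *)

(** * Cardinal comparison by functions *)

Lemma card_le_fun (T U : Type) (A : set T) (B : set U) (u0 : U) :
  A #<= B -> exists f : T -> U, (forall x, A x -> B (f x)) /\
    forall x y, A x -> A y -> f x = f y -> x = y.
Proof.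
move=> /card_leP[f].
pose g x := if pselect (A x) is left h then set_val (f (SigSub (mem_set h))) else u0.
exists g; split=> [x Ax|x y Ax Ay]; rewrite /g.
  by case: pselect => // h; apply: set_valP.
case: pselect => // hx; case: pselect => // hy /val_inj fxy.
have /(_ fxy) : f (SigSub (mem_set hx)) = f (SigSub (mem_set hy)) ->
  SigSub (mem_set hx) = SigSub (mem_set hy) by apply: inj; rewrite inE.
by move=> /(congr1 val).
Qed.

Lemma fun_card_le (T U : Type) (A : set T) (B : set U) (f : T -> U) :
  (forall x, A x -> B (f x)) ->
  (forall x y, A x -> A y -> f x = f y -> x = y) -> A #<= B.
Proof.
move=> fB finj.
have /card_eqPle[_ AfA] : f @` A #= A.
  by apply: inj_card_eq => x y /set_mem Ax /set_mem Ay; apply: finj.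
by apply: (card_le_trans AfA); apply: subset_card_le => _ [x Ax <-]; exact: fB.
Qed.

Lemma fun_card_eq (T U : Type) (A : set T) (B : set U) (f : T -> U) :
  (forall x, A x -> B (f x)) ->
  (forall x y, A x -> A y -> f x = f y -> x = y) ->
  (forall y, B y -> exists2 x, A x & f x = y) -> A #= B.
Proof.
move=> fB finj fsurj.
have <- : f @` A = B.
  by apply/seteqP; split=> [_ [x Ax <-]|y /fsurj[x Ax <-]]; [exact: fB|exists x].
by rewrite card_eq_sym; apply: inj_card_eq => x y /set_mem Ax /set_mem Ay; apply: finj.
Qed.

Section Ordinals.
Context {d : Order.disp_t} {O : bOrderType d} (wfO : well_ordered O).
Implicit Types (a b A B C D E X : set O).
Implicit Types (i j x y z mu nu sigma tau theta kappa alpha beta gamma delta eps xi zeta lambda : O).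

(** * Least elements, suprema and limit points *)

Lemma ord_ind (P : O -> Prop) : (forall x, (forall y, y < x -> P y) -> P x) -> forall x, P x.
Proof. by move=> h x; apply: (well_founded_ind wfO). Qed.

Lemma least_ex A x : A x -> exists2 m, A m & forall y, A y -> m <= y.
Proof.
elim/ord_ind: x => x IH Ax.
have [[y [Ay yx]]|h] := pselect (exists y, A y /\ y < x); first exact: IH yx Ay.
by exists x => // y Ay; rewrite leNgt; apply/negP => yx; apply: h; exists y.
Qed.

Lemma omin_eq A m : A m -> (forall y, A y -> m <= y) -> omin A = m.
Proof.
move=> Am mA; rewrite /omin /infimum ifF; last first.
  by apply/eqP => A0; rewrite A0 in Am.
apply: xget_unique; first by split=> // y; apply.
move=> y [ylb ymax]; apply/eqP; rewrite eq_le ylb //=; exact: ymax.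
Qed.

Lemma omin_mem A x : A x -> A (omin A).
Proof. by move=> /least_ex[m Am mA]; rewrite (omin_eq Am mA). Qed.

Lemma omin_le A x : A x -> omin A <= x.
Proof. by move=> Ax; have [m Am mA] := least_ex Ax; rewrite (omin_eq Am mA); exact: mA. Qed.

Lemma osup_lub A beta : (forall y, A y -> y <= beta) ->
  (forall y, A y -> y <= osup A) /\ osup A <= beta.
Proof.
move=> Ab.
have [->|/set0P A0] := eqVneq A set0; first by rewrite /osup supremum0 le0x; split.
have [m mub mmin] : exists2 m, ubound A m & forall y, ubound A y -> m <= y.
  by apply: (@least_ex (ubound A) beta).
have -> : osup A = m.
  rewrite /osup /supremum ifF; last by apply/eqP => A0'; rewrite A0' in A0; case: A0.
  apply: xget_unique; first by split.
  move=> y [yub ymin]; apply/eqP; rewrite eq_le mmin // andbT.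
  by apply: ymin.
by split=> //; exact: mmin.
Qed.

Lemma le_osup A beta x : (forall y, A y -> y <= beta) -> A x -> x <= osup A.
Proof. by move=> /osup_lub[h _]; exact: h. Qed.

Lemma osup_le A beta : (forall y, A y -> y <= beta) -> osup A <= beta.
Proof. by move=> /osup_lub[]. Qed.

Lemma lt_succ x y : x < y -> x < succ x.
Proof. by move=> xy; exact: (@omin_mem [set z | x < z] y). Qed.

Lemma succ_le x y : x < y -> succ x <= y.
Proof. by move=> xy; exact: (@omin_le [set z | x < z] y). Qed.

Lemma lt_succ_le x y : x < succ y -> x <= y.
Proof.
move=> xy; rewrite leNgt; apply/negP => yx.
by have := succ_le yx; rewrite leNgt xy.
Qed.

(** The condition on [delta] in [accp a], stated by approximation from below; see
    [limit_of_osup]. *)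
Definition limit_of a delta : Prop :=
  \bot < delta /\ forall xi, xi < delta -> exists x, [/\ a x, xi < x & x < delta].

Definition limit delta : Prop := limit_of setT delta.

Lemma limit_of_osup a delta :
  limit_of a delta <-> osup (a `&` below delta) = delta /\ \bot < delta.
Proof.
have ub y : (a `&` below delta) y -> y <= delta by case=> _ /ltW.
split=> [[d0 h]|[sd d0]]; split=> //.
  apply/eqP; rewrite eq_le osup_le //= leNgt; apply/negP => /h[x [ax sx xd]].
  have : x <= osup (a `&` below delta) by apply: (le_osup ub).
  by rewrite leNgt sx.
move=> xi xid; apply: contrapT => h.
suff : delta <= xi by rewrite leNgt xid.
rewrite -sd; apply: osup_le => y [ay yd]; rewrite leNgt; apply/negP => xiy.
by apply: h; exists y.
Qed.

Lemma limit_of_sub a b delta : (forall x, x < delta -> a x -> b x) ->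
  limit_of a delta -> limit_of b delta.
Proof.
move=> ab [d0 h]; split=> // xi /h[x [ax xix xd]]; exists x; split=> //; exact: ab.
Qed.

Lemma limit_of_limit a delta : limit_of a delta -> limit delta.
Proof. exact: limit_of_sub. Qed.

Lemma limit_of_limit_of a delta : limit_of (limit_of a) delta -> limit_of a delta.
Proof.
move=> [d0 h]; split=> // xi /h[x [[x0 ax] xix xd]].
have [y [ay xiy yx]] := ax _ xix.
by exists y; split=> //; exact: lt_trans xd.
Qed.

Lemma accP a kappa delta : a `<=` below kappa ->
  acc a delta <-> a delta /\ limit_of a delta.
Proof.
move=> ak; split=> [[ad [_ h]]|[ad h]]; first by split=> //; apply/limit_of_osup.
split=> //; split; last by apply/limit_of_osup.
have dk : delta < kappa by exact: ak.
apply: (lt_le_trans (lt_succ dk)).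
apply: (@le_osup _ kappa); last by exists delta.
by move=> _ [x /ak xk <-]; exact: succ_le.
Qed.

Lemma limit_succ delta x : limit delta -> x < delta -> succ x < delta.
Proof.
move=> [_ h] xd; have [y [_ xy yd]] := h _ xd.
exact: le_lt_trans (succ_le xy) yd.
Qed.

Lemma is_limitP delta : is_limit delta <-> limit delta.
Proof.
split=> [[d0 ns]|dl].
  split=> // xi xid; apply: contrapT => h; apply: ns; exists xi => //.
  apply/eqP; rewrite eq_le succ_le // andbT leNgt; apply/negP => sd.
  by apply: h; exists (succ xi); split=> //; exact: lt_succ xid.
split; first by case: dl.
by case=> x xd E; have := limit_succ dl xd; rewrite -E ltxx.
Qed.

Lemma not_limit_pred zeta : ~ limit zeta -> zeta <> \bot ->
  exists2 eta, eta < zeta & forall x, x < zeta -> x <= eta.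
Proof.
move=> nlim /eqP z0; apply: contrapT => none; apply: nlim; split=> [|xi xz]; first by rewrite lt0x.
apply: contrapT => none'; apply: none; exists xi => // x xz'.
by rewrite leNgt; apply/negP => xx; apply: none'; exists x.
Qed.

Lemma acc_belowP kappa alpha : acc (below kappa) alpha <-> alpha < kappa /\ limit alpha.
Proof.
rewrite (@accP _ kappa) //; split=> -[ak h]; split=> //.
  exact: limit_of_limit h.
by apply: limit_of_sub h => x xa _; exact: lt_trans ak.
Qed.

Lemma closed_inP C alpha : closed_in C alpha <->
  C `<=` below alpha /\ forall gamma, gamma < alpha -> limit_of C gamma -> C gamma.
Proof.
split=> -[Ca h]; split=> //.
  by move=> gamma ga /limit_of_osup[? ?]; apply: h.
by move=> gamma ga g0 E; apply: h => //; apply/limit_of_osup.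
Qed.

Lemma clubP C kappa : \bot < kappa -> club C kappa <->
  [/\ C `<=` below kappa, forall gamma, gamma < kappa -> limit_of C gamma -> C gamma &
    limit_of C kappa].
Proof.
move=> k0; rewrite /club closed_inP; split=> [[[Ck h] E]|[Ck h l]].
  split=> //; apply/limit_of_osup; split=> //.
  by rewrite (_ : C `&` below kappa = C) // setIidl.
by split=> //; move/limit_of_osup: l => [<- _]; rewrite setIidl.
Qed.

(** * Enumerations and small sets *)

(** Transfinite enumeration without repetitions.  If [pick] takes least elements
    the enumeration is increasing and computes order types; for an arbitrary
    [pick] it compares cardinals. *)
Lemma enum_ex (U : Type) (T : set U) (pick : set U -> U) :
  exists e : O -> U, forall i, e i = pick (T `\` e @` below i).
Proof.
pose F i (f : forall j : O, j < i -> U) : U :=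
  pick (T `\` [set u | exists j (h : j < i), f j h = u]).
exists (Fix wfO (fun=> U) F) => i.
rewrite Fix_eq => [|x f g fg]; rewrite /F; last first.
  congr (pick (_ `\` _)); apply/funext => u; apply/propext.
  by split=> -[j [h <-]]; exists j, h; rewrite fg.
congr (pick (_ `\` _)); apply/seteqP; split=> [u [j [h <-]]|u [j h <-]].
  by exists j.
by exists j, h.
Qed.

Lemma enum_stop (U : Type) (T : set U) (pick : set U -> U) (e : O -> U) :
  (forall S, S `<=` T -> S !=set0 -> S (pick S)) ->
  (forall i, e i = pick (T `\` e @` below i)) -> forall theta,
  (forall i, i < theta -> (T `\` e @` below i) (e i)) \/
  exists2 tau, tau < theta &
    (forall i, i < tau -> (T `\` e @` below i) (e i)) /\ T `<=` e @` below tau.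
Proof.
move=> pickP eE theta.
have run i : ~ T `<=` e @` below i -> (T `\` e @` below i) (e i).
  move=> nT; rewrite eE; apply: pickP; first by move=> u [].
  apply: contrapT => h; apply: nT => u Tu; apply: contrapT => neu.
  by apply: h; exists u.
have [[tau [tt Tt]]|h] := pselect (exists tau, tau < theta /\ T `<=` e @` below tau).
  have [m [mt mT] mmin] := @least_ex [set t | t < theta /\ T `<=` e @` below t] tau (conj tt Tt).
  right; exists m => //; split=> // i im; apply: run => Ti.
  by have := mmin _ (conj (lt_trans im mt) Ti); rewrite leNgt im.
by left=> i it; apply: run => Ti; apply: h; exists i.
Qed.

Lemma enum_inj (U : Type) (T : set U) (e : O -> U) tau :
  (forall i, i < tau -> (T `\` e @` below i) (e i)) ->
  forall i j, i < tau -> j < tau -> e i = e j -> i = j.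
Proof.
move=> h i j it jt eij.
case: (ltgtP i j) => // [ij|ji].
  by have [_ []] := h _ jt; exists i.
by have [_ []] := h _ it; exists j.
Qed.

(** Comparability of cardinals: enumerate [T] along [theta] and see which of the
    two is exhausted first. *)
Lemma card_below_total (U : Type) (T : set U) theta :
  below theta #<= T \/ exists2 tau, tau < theta & T #= below tau.
Proof.
have [u0|T0] := pselect (exists u, T u); last first.
  have -> : T = set0 by apply/seteqP; split=> // u Tu; case: T0; exists u.
  have [->|t0] := eqVneq theta \bot.
    left; rewrite (_ : below \bot = set0) ?card_ge0 //.
    by apply/seteqP; split=> // x; rewrite /below /= ltx0.
  right; exists \bot; first by rewrite lt0x.
  rewrite (_ : below \bot = set0) ?card_eq00 //.
  by apply/seteqP; split=> // x; rewrite /below /= ltx0.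
have [u Tu] := u0.
pose pick (S : set U) := if pselect (S !=set0) is left h then sval (cid h) else u.
have pickP S : S `<=` T -> S !=set0 -> S (pick S).
  by rewrite /pick => _ S0; case: pselect => // h; case: cid.
have [e eE] := enum_ex T pick.
have [h|[tau tt [h sT]]] := enum_stop pickP eE theta.
  left; apply: (@fun_card_le _ _ _ _ e) => [i it|]; first by have [] := h _ it.
  exact: enum_inj h.
right; exists tau => //; rewrite card_eq_sym.
apply: (@fun_card_eq _ _ _ _ e) => [i it||v /sT[i]]; first by have [] := h _ it.
  exact: enum_inj h.
by exists i.
Qed.

Lemma strict_incr_ge (f : O -> O) tau : (forall i j, i < j -> j < tau -> f i < f j) ->
  forall i, i < tau -> i <= f i.
Proof.
move=> h; elim/ord_ind => i IH it; rewrite leNgt; apply/negP => fi.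
have := IH _ fi (lt_trans fi it); rewrite leNgt; move/negP; apply.
exact: h.
Qed.

(** The increasing enumeration [e] of [B] satisfies [i <= e i], so it is
    exhausted by stage [beta]. *)
Lemma otp_ex B beta : B `<=` below beta -> exists2 tau, tau <= beta &
  exists f : O -> O, set_bij (below tau) B f /\
    forall x y, x < y -> y < tau -> f x < f y.
Proof.
move=> Bb.
have pickP S : S `<=` B -> S !=set0 -> S (omin S) by move=> _ [x]; exact: omin_mem.
have [e eE] := enum_ex B omin.
have incr tau : (forall i, i < tau -> (B `\` e @` below i) (e i)) ->
    forall i j, i < j -> j < tau -> e i < e j.
  move=> h i j ij jt; have [Bj nj] := h _ jt.
  rewrite lt_neqAle; apply/andP; split.
    by apply/eqP => E; apply: nj; exists i.
  rewrite eE; apply: omin_le; split=> // -[k ki ek]; apply: nj; exists k => //.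
  exact: lt_trans ij.
have fin tau : (forall i, i < tau -> (B `\` e @` below i) (e i)) -> B `<=` e @` below tau ->
    exists f : O -> O, set_bij (below tau) B f /\ forall x y, x < y -> y < tau -> f x < f y.
  move=> h sB; exists e; split; last exact: incr.
  split=> [i it|x y /set_mem xt /set_mem yt|x /sB[i it <-]]; first by have [] := h _ it.
    exact: (enum_inj h).
  by exists i.
have [h|[tau tb [h sB]]] := enum_stop pickP eE beta; last first.
  by exists tau; [exact: ltW|exact: fin].
exists beta => //; apply: fin => // x Bx; apply: contrapT => nx.
have xb := Bb _ Bx.
have [ex|ne] := pselect (B `<=` e @` below x).
  by have [i ix ei] := ex _ Bx; apply: nx; exists i => //; exact: lt_trans xb.
have exx : e x <= x.
  rewrite eE; apply: omin_le; split=> // -[i ix ei]; apply: nx; exists i => //; exact: lt_trans xb.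
have := strict_incr_ge (incr _ h) xb; rewrite le_eqVlt => /orP[/eqP E|]; last by rewrite ltNge exx.
by apply: nx; exists x => //; rewrite -E.
Qed.

(** For an initial ordinal [mu]: [X] has fewer than [mu] elements. *)
Definition small (U : Type) mu (X : set U) : Prop :=
  exists2 tau, tau < mu & X #<= below tau.

Lemma small_below mu tau : tau < mu -> small mu (below tau).
Proof. by exists tau. Qed.

Lemma small_le (U V : Type) mu (X : set U) (Y : set V) : X #<= Y -> small mu Y -> small mu X.
Proof. by move=> XY [tau tm Yt]; exists tau => //; exact: card_le_trans Yt. Qed.

Lemma small_mono (U : Type) mu nu (X : set U) : mu <= nu -> small mu X -> small nu X.
Proof. by move=> mn [tau tm Xt]; exists tau => //; exact: lt_le_trans mn. Qed.

Lemma not_small (U : Type) mu (X : set U) : ~ small mu X -> below mu #<= X.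
Proof.
case: (card_below_total X mu) => // -[tau tm /card_eqPle[Xt _]] []; by exists tau.
Qed.

Lemma small_finite (U : Type) mu (X : set U) :
  infinite_set (below mu) -> finite_set X -> small mu X.
Proof.
move=> mi Xf; apply: contrapT => /not_small h; apply: mi; exact: card_le_finite Xf.
Qed.

Lemma finite_max A x : finite_set A -> A x -> exists2 m, A m & forall y, A y -> y <= m.
Proof.
move=> /finite_seqP[s ->] /=; elim: s x => // x s IH _ _.
have [[y sy]|none] := pselect (exists y, y \in s); last first.
  exists x => [|y]; rewrite /= inE ?eqxx // => /orP[/eqP->//|sy]; by case: none; exists y.
have [m sm mP] := IH y sy.
have sm' : m \in s := sm.
exists (Order.max x m) => [|z]; rewrite /= inE.
  by case: leP => _; rewrite ?eqxx // sm' orbT.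
by rewrite le_max => /orP[/eqP->|/mP->]; rewrite ?lexx ?orbT.
Qed.

Lemma finite_bound A delta : limit delta -> finite_set A -> A `<=` below delta ->
  exists2 e, e < delta & forall x, A x -> x < e.
Proof.
move=> lim fA Ad; have [[x Ax]|none] := pselect (exists x, A x); last first.
  by exists \bot => [|x Ax]; [case: lim|case: none; exists x].
have [m Am mP] := finite_max fA Ax; have md := Ad _ Am.
exists (succ m); first exact: limit_succ.
by move=> y /mP ym; apply: le_lt_trans ym _; exact: lt_succ md.
Qed.

Lemma limit_of_infinite A delta : limit_of A delta -> infinite_set (A `&` below delta).
Proof.
move=> lA fA; have [|e ed eP] := finite_bound (limit_of_limit lA) fA; first by move=> x [].
have [_ /(_ _ ed)[x [Ax ex xd]]] := lA.
by have := eP _ (conj Ax xd); rewrite ltNge ltW.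
Qed.

Lemma cf_cofinal delta : exists2 a, cofinal_in a delta & a #= below (cf delta).
Proof.
have : [set beta | exists2 a, cofinal_in a delta & a #= below beta] delta.
  exists (below delta); last exact: card_eqxx.
  by split=> // x xd; exists x.
exact: omin_mem.
Qed.

Lemma cf_le delta : cf delta <= delta.
Proof.
apply: omin_le; exists (below delta); last exact: card_eqxx.
by split=> // x xd; exists x.
Qed.

(** Otherwise the values of [f] would form a cofinal subset of [delta] of size
    less than [cf delta]. *)
Lemma cf_bound (U : Type) delta (X : set U) (f : U -> O) : small (cf delta) X ->
  (forall u, X u -> f u < delta) ->
  exists2 eps, eps < delta & forall u, X u -> f u < eps.
Proof.
move=> [tau tcf Xt] fd; apply: contrapT => nb.
have cof : cofinal_in (f @` X) delta.
  split=> [_ [u Xu <-]|x xd]; first exact: fd.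
  apply: contrapT => nx; apply: nb; exists x => // u Xu.
  by rewrite ltNge; apply/negP => xu; apply: nx; exists (f u) => //; exists u.
have le : f @` X #<= below tau by apply: card_le_trans Xt; exact: card_image_le.
have [sg sgt fs] : exists2 sg, sg <= tau & f @` X #= below sg.
  have [tf|[sg st h]] := card_below_total (f @` X) tau; last by exists sg => //; exact: ltW.
  by exists tau => //; apply: Cantor_Bernstein.
have : cf delta <= sg by apply: omin_le; exists (f @` X).
by rewrite leNgt (le_lt_trans sgt tcf).
Qed.

(** Let [nu] number a cofinal subset [a] of [delta] by ordinals below
    [cf delta].  If [b] were a shorter cofinal subset of [cf delta], then the
    bounds [f i], for [i] in [b], of the part of [a] numbered up to [i] would be
    few, hence bounded below [delta]. *)
Lemma cf_regular delta : limit delta -> infinite_regular (cf delta).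
Proof.
move=> limd; have [a [ad acof] aeq] := cf_cofinal delta; split.
  move=> fin; have fa : finite_set a by move: fin; rewrite -(eq_finite_set aeq).
  have [e ed eP] := finite_bound limd fa ad.
  by have [y ay ey] := acof _ ed; have := eP _ ay; rewrite ltNge ey.
apply/eqP; rewrite eq_le cf_le leNgt; apply/negP => lt.
have [b [bd bcof] beq] := cf_cofinal (cf delta).
have /card_eqPle[ale _] := aeq.
have [nu [nuP nuinj]] := card_le_fun \bot ale.
have /choice[f fP] : forall i, exists e, b i -> e < delta /\ forall x, a x -> nu x <= i -> x < e.
  move=> i; have [bi|] := pselect (b i); last by exists \bot.
  have [|x [/ad//]|e ed eP] := @cf_bound _ delta (a `&` [set x | nu x < i]) id.
    exists i; first exact: bd.
    apply: (@fun_card_le _ _ _ _ nu) => [x []//|x y [ax _] [ay _]].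
    exact: nuinj.
  have [[y [ay nuy]]|none] := pselect (exists y, a y /\ nu y = i); last first.
    exists e => _; split=> // x ax; rewrite le_eqVlt => /orP[/eqP E|xi]; last by apply: eP; split.
    by case: none; exists x.
  have yd := ad _ ay; exists (Order.max e (succ y)) => _; split.
    by rewrite gt_max ed limit_succ.
  move=> x ax; rewrite le_eqVlt lt_max => /orP[/eqP E|xi]; last by rewrite eP.
  by rewrite (nuinj _ _ ax ay) ?nuy // (lt_succ yd) orbT.
have [|i /fP[]//|e ed eP] := @cf_bound _ delta b f.
  by exists (cf (cf delta)) => //; have /card_eqPle[] := beq.
have [x ax ex] := acof _ ed; have [i bi xi] := bcof _ (nuP _ ax).
have [_ /(_ x ax xi) xf] := fP _ bi.
by have := lt_trans xf (eP _ bi); rewrite ltNge ex.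
Qed.

(** The least [delta] below which [X] has infinitely many elements is a limit
    point of [X]. *)
Lemma infinite_limit X alpha : infinite_set X -> X `<=` below alpha ->
  exists2 delta, delta <= alpha & limit_of X delta.
Proof.
move=> Xinf Xa.
pose S := [set delta | infinite_set (X `&` below delta)].
have Sa : S alpha by rewrite /S /= setIidl.
have [delta Sd dmin] := least_ex Sa.
exists delta; first exact: dmin.
split=> [|xi xd].
  rewrite lt0x; apply/eqP => d0; apply: Sd; rewrite d0 (_ : X `&` _ = set0); last first.
    by apply/seteqP; split=> // x []; rewrite /below /= ltx0.
  exact: finite_set0.
apply: contrapT => none; apply: Sd.
have fin : finite_set (X `&` below xi).
  by apply: contrapT => inf; have := dmin _ inf; rewrite leNgt xd.
apply: (@sub_finite_set _ _ ((X `&` below xi) `|` [set xi])).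
  move=> x [Xx xdel]; case: (ltgtP x xi) => [xx|xx|->]; [by left|exfalso|by right].
  by apply: none; exists x.
by rewrite finite_setU; split.
Qed.

End Ordinals.

(** * Regular cardinals and positive sets *)

Section Regular.
Context {d : Order.disp_t} {O : bOrderType d} (wfO : well_ordered O).
Implicit Types (a b A B C D E X Y : set O).
Implicit Types (i j x y z mu nu sigma tau theta kappa alpha beta gamma delta eps xi zeta lambda : O).

Lemma cf_limit delta : infinite_set (below (cf delta)) -> limit delta.
Proof.
move=> inf; split=> [|xi xid].
  have [|//|e ed _] := @cf_bound _ _ wfO O delta set0 id; last exact: le_lt_trans ed.
  exact/(small_finite wfO inf)/finite_set0.
have [||e ed h] := @cf_bound _ _ wfO O delta [set xi] id.
- exact/(small_finite wfO inf)/finite_set1.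
- by move=> _ ->.
by exists e; split=> //; exact: h.
Qed.

Section Kappa.
Context (kappa : O) (reg_kappa : infinite_regular kappa).

Lemma regular_limit : limit kappa.
Proof. by apply: cf_limit; case: reg_kappa => inf ->. Qed.

Lemma regular_gt0 : \bot < kappa. Proof. by case: regular_limit. Qed.

Lemma regular_succ xi : xi < kappa -> succ xi < kappa.
Proof. by move=> xik; apply: limit_succ xik => //; exact: regular_limit. Qed.

Lemma regular_bound (U : Type) (X : set U) (f : U -> O) : small kappa X ->
  (forall u, X u -> f u < kappa) ->
  exists2 eps, eps < kappa & forall u, X u -> f u < eps.
Proof. by case: reg_kappa => _ E; rewrite -{1}E; apply: cf_bound. Qed.

Lemma regular_not_small : ~ small kappa (below kappa).
Proof.
move=> s; have [//|e ek h] := @regular_bound O _ id s.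
by have := h _ ek; rewrite ltxx.
Qed.

Lemma unbounded_card X : X `<=` below kappa ->
  (forall xi, xi < kappa -> exists2 x, X x & xi < x) -> X #= below kappa.
Proof.
move=> Xk Xu; apply: Cantor_Bernstein; first exact: subset_card_le.
apply: not_small => // s.
have [e ek h] := @regular_bound O _ id s Xk.
have [x Xx ex] := Xu _ ek.
by have := lt_trans ex (h _ Xx); rewrite ltxx.
Qed.

(** The bound on the earlier values lets the arguments below replace [xi] by a
    larger point, such as a member of a cofinal sequence or a maximum. *)
Lemma dominating_fun (g : O -> O) : (forall xi, xi < kappa -> g xi < kappa) ->
  exists G : O -> O, forall xi, xi < kappa ->
    [/\ G xi < kappa, xi < G xi & forall zeta, zeta <= xi -> g zeta < G xi].
Proof.
move=> gk.
suff /choice[G GP] : forall xi, exists eta, xi < kappa ->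
  [/\ eta < kappa, xi < eta & forall zeta, zeta <= xi -> g zeta < eta] by exists G.
move=> xi.
have [xik|_] := boolP (xi < kappa); last by exists \bot.
have sxik := regular_succ xik.
have [|zeta /= zx|e ek h] := @regular_bound O (below (succ xi)) g.
- exact: small_below.
- by apply: gk; exact: lt_trans sxik.
exists (Order.max e (succ xi)) => _; split; first by rewrite gt_max ek.
  by rewrite lt_max (lt_succ wfO xik) orbT.
move=> zeta zx; rewrite lt_max h //; apply: le_lt_trans zx _; exact: lt_succ xik.
Qed.

Section Mu.
Context (mu : O) (reg_mu : Reg kappa mu).

(** The limit of [mu] steps of [G], which is of cofinality [mu] as [mu] is
    regular. *)
Lemma closure_point (g : O -> O) xi0 : (forall xi, xi < kappa -> g xi < kappa) ->
  xi0 < kappa -> exists delta,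
    [/\ xi0 < delta, delta < kappa, cf delta = mu & forall xi, xi < delta -> g xi < delta].
Proof.
move=> gk x0k; have [G GP] := dominating_fun gk.
have [muk regm] := reg_mu.
(* [s i] is the least ordinal above [xi0] and above all earlier [G (s j)] *)
pose ok (i eta : O) (f : forall j : O, j < i -> O) :=
  [/\ eta < kappa, xi0 < eta & forall j (h : j < i), G (f j h) < eta].
pose F i (f : forall j : O, j < i -> O) := omin [set eta | ok i eta f].
pose s := Fix wfO (fun=> O) F.
have sE i : s i = omin [set eta | ok i eta (fun j _ => s j)].
  rewrite /s Fix_eq // => x f f' ff'; congr (omin _); apply/funext => eta.
  apply/propext; split=> -[ek xe h]; split=> // j hj; first by rewrite -ff'.
  by rewrite ff'.
have sP i : i < kappa -> ok i (s i) (fun j _ => s j).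
  elim/(ord_ind wfO): i => i IH ik.
  have [|j /= ji|e ek h] := @regular_bound O (below i) (G \o s); first exact: small_below.
    have jk := lt_trans ji ik.
    by have [sj _ _] := IH j ji jk; have [] := GP _ sj.
  rewrite sE; apply: (@omin_mem _ _ wfO [set eta | ok i eta (fun j _ => s j)] (Order.max e (succ xi0))).
  split; first by rewrite gt_max ek regular_succ.
    by rewrite lt_max (lt_succ wfO x0k) orbT.
  by move=> j ji; rewrite lt_max h.
have sincr i j : i < j -> j < kappa -> s i < s j.
  move=> ij jk; have [sik _ _] := sP _ (lt_trans ij jk).
  have [_ _ h] := sP _ jk; have [_ sG _] := GP _ sik.
  exact: lt_trans sG (h _ ij).
have [|i /= im|e ek eP] := @regular_bound O (below mu) s; first exact: small_below.
  by have [] := sP _ (lt_trans im muk).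
have limm : limit mu by apply: cf_limit; case: regm => ? ->.
pose S := [set x | forall i, i < mu -> s i < x].
have Se : S e by move=> i; exact: eP.
have dS : S (omin S) by exact: omin_mem Se.
have dmin x : x < omin S -> exists2 i, i < mu & x <= s i.
  move=> xd; apply: contrapT => h.
  suff : omin S <= x by rewrite leNgt xd.
  apply: omin_le => // i im; rewrite ltNge; apply/negP => xs; apply: h; by exists i.
exists (omin S); split.
- have m0 : \bot < mu by case: limm.
  by have [_ h _] := sP _ (lt_trans m0 muk); apply: lt_trans h _; exact: dS.
- by apply: le_lt_trans ek; exact: omin_le.
- apply: omin_eq => // [|beta [a [asub acof] aeq]].
    exists (s @` below mu).
      split=> [_ [i im <-]|x /dmin[i im xs]]; first exact: dS.
      by exists (s i) => //; exists i.
    apply: inj_card_eq => i j /set_mem im /set_mem jm sij.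
    by case: (ltgtP i j) => // [ij|ji];
      [have := sincr _ _ ij (lt_trans jm muk)|have := sincr _ _ ji (lt_trans im muk)];
      rewrite sij ltxx.
  rewrite leNgt; apply/negP => bm.
  have /choice[r rP] : forall x, exists i, a x -> i < mu /\ x <= s i.
    move=> x; have [ax|nax] := pselect (a x); last by exists x.
    by have [i im xs] := dmin x (asub _ ax); exists i.
  have [||k km kP] := @cf_bound _ _ wfO O mu a r.
  - case: regm => _ ->; exists beta => //; by have /card_eqPle[] := aeq.
  - by move=> x /rP[].
  have [y ay sy] := acof _ (dS _ km).
  have [ry yr] := rP _ ay.
  have := sincr _ _ (kP _ ay) (lt_trans km muk).
  by rewrite ltNge (le_trans sy yr).
- move=> xi /dmin[i im xs].
  have im' : succ i < mu by exact: limit_succ.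
  have [sik _ _] := sP _ (lt_trans im muk).
  have [_ _ Gh] := GP _ sik.
  apply: lt_trans (Gh _ xs) _; apply: lt_trans (dS _ im').
  have [_ _ h] := sP _ (lt_trans im' muk); apply: h; exact: lt_succ im.
Qed.

Lemma common_limits A B xi : (forall x, x < kappa -> exists y, [/\ A y, x < y & y < kappa]) ->
  (forall x, x < kappa -> exists y, [/\ B y, x < y & y < kappa]) -> xi < kappa ->
  exists delta, [/\ xi < delta, delta < kappa, cf delta = mu, limit_of A delta & limit_of B delta].
Proof.
move=> Au Bu xik.
have next X : (forall x, x < kappa -> exists y, [/\ X y, x < y & y < kappa]) ->
    exists g : O -> O, forall x, x < kappa -> [/\ X (g x), x < g x & g x < kappa].
  move=> Xu; suff /choice[g gP] : forall x, exists y, x < kappa -> [/\ X y, x < y & y < kappa].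
    by exists g.
  move=> x; have [/Xu[y yP]|?] := pselect (x < kappa); last by exists \bot.
  by exists y.
have [g gP] := next _ Au; have [h hP] := next _ Bu.
have [x xk|delta [xd dk cd cl]] := closure_point (g := fun x => Order.max (g x) (h x)) _ xik.
  by have [_ _ gk] := gP _ xk; have [_ _ hk] := hP _ xk; rewrite gt_max gk.
have d0 : \bot < delta by apply: le_lt_trans xd; exact: le0x.
exists delta; split=> //; split=> // x xd'; have := cl _ xd'; rewrite gt_max => /andP[gd hd].
  by exists (g x); have [] := gP _ (lt_trans xd' dk).
by exists (h x); have [] := hP _ (lt_trans xd' dk).
Qed.

(** Stationarity within the ordinals of cofinality [mu]: closure points of
    functions replace the members of clubs. *)
Definition positive X : Prop := forall g : O -> O,
  (forall xi, xi < kappa -> g xi < kappa) ->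
  exists delta, [/\ delta < kappa, cf delta = mu,
    forall xi, xi < delta -> g xi < delta & X delta].

Lemma positive_full : positive setT.
Proof.
move=> g gk; have [delta [_ dk cd cl]] := closure_point gk (regular_gt0).
by exists delta.
Qed.

Lemma positive_sub X Y : (forall delta, delta < kappa -> cf delta = mu -> X delta -> Y delta) ->
  positive X -> positive Y.
Proof.
by move=> XY pX g /pX[delta [dk cd cl Xd]]; exists delta; split=> //; exact: XY.
Qed.

Lemma cf_mu_limit delta : cf delta = mu -> limit delta.
Proof. by move=> E; apply: cf_limit; rewrite E; case: reg_mu => _ []. Qed.

Lemma positive_closed X (g : O -> O) : (forall xi, xi < kappa -> g xi < kappa) ->
  positive X -> positive [set delta | X delta /\ forall xi, xi < delta -> g xi < delta].
Proof.
move=> gk pX h hk.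
have [xi xik|delta [dk cd cl Xd]] := pX (fun xi => Order.max (g xi) (h xi)).
  by rewrite gt_max gk ?hk.
exists delta; split=> // [xi /cl|]; first by rewrite gt_max => /andP[].
by split=> // xi /cl; rewrite gt_max => /andP[].
Qed.

Lemma positive_unbounded X xi : positive X -> xi < kappa ->
  exists delta, [/\ xi < delta, delta < kappa, cf delta = mu & X delta].
Proof.
move=> pX xik; have [delta [dk cd cl Xd]] := pX (fun=> xi) (fun _ _ => xik).
exists delta; split=> //; apply: (cl \bot); by case: (cf_mu_limit cd).
Qed.

Lemma positive_or X Y : positive (X `|` Y) -> positive X \/ positive Y.
Proof.
move=> pXY; apply: contrapT => /not_orP[/existsNP[g /not_implyP[gk ng]] /existsNP[h /not_implyP[hk nh]]].
have [xi xik|delta [dk cd cl]] := pXY (fun xi => Order.max (g xi) (h xi)).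
  by rewrite gt_max gk ?hk.
have cl1 xi : xi < delta -> g xi < delta by move=> /cl; rewrite gt_max => /andP[].
have cl2 xi : xi < delta -> h xi < delta by move=> /cl; rewrite gt_max => /andP[].
by case=> [Xd|Yd]; [apply: ng|apply: nh]; exists delta.
Qed.

(** Fodor's lemma: the closure functions witnessing that the fibres are not
    positive can be merged diagonally into a single one. *)
Lemma fodor X (f : O -> O) : positive X ->
  (forall delta, delta < kappa -> cf delta = mu -> X delta -> f delta < delta) ->
  exists2 eps, eps < kappa & positive [set delta | X delta /\ f delta = eps].
Proof.
move=> pX fX; apply: contrapT => none.
have /choice[g gP] : forall eps, exists g : O -> O, eps < kappa ->
    (forall xi, xi < kappa -> g xi < kappa) /\
    forall delta, delta < kappa -> cf delta = mu -> (forall xi, xi < delta -> g xi < delta) ->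
      X delta -> f delta <> eps.
  move=> eps; have [ek|nek] := pselect (eps < kappa); last by exists id.
  apply: contrapT => h; apply: none; exists eps => // g gk.
  apply: contrapT => ng; apply: h; exists g => _; split=> // delta dk cd cl Xd fd.
  by apply: ng; exists delta.
have /choice[G1 G1P] : forall eps, exists G : O -> O, eps < kappa -> forall xi, xi < kappa ->
    [/\ G xi < kappa, xi < G xi & forall zeta, zeta <= xi -> g eps zeta < G xi].
  move=> eps; have [ek|nek] := pselect (eps < kappa); last by exists id.
  by have [gk _] := gP _ ek; have [G GP] := dominating_fun gk; exists G.
have /choice[H HP] : forall xi, exists eta, xi < kappa ->
    eta < kappa /\ forall eps, eps <= xi -> G1 eps xi < eta.
  move=> xi; have [xik|nxik] := pselect (xi < kappa); last by exists \bot.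
  have sxik := regular_succ xik.
  have [|eps /= ex|e ek h] := @regular_bound O (below (succ xi)) (G1 ^~ xi).
  - exact: small_below.
  - by have [] := G1P eps (lt_trans ex sxik) _ xik.
  exists e => _; split=> // eps ex; apply: h; apply: le_lt_trans ex _; exact: lt_succ xik.
have [xi xik|delta [dk cd cl Xd]] := pX H; first by have [] := HP _ xik.
have fd := fX _ dk cd Xd.
have [_ /(_ delta dk cd)] := gP _ (lt_trans fd dk); apply=> // xi xid.
(* the arguments [xi] and [f delta] of the diagonal are both below [delta] *)
have md : Order.max xi (f delta) < delta by rewrite gt_max xid.
have mk := lt_trans md dk.
have [_ _ h1] := G1P _ (lt_trans fd dk) _ mk.
have [_ h2] := HP _ mk.
apply: lt_trans (cl _ md); apply: lt_trans (h2 (f delta) _); last by rewrite le_max lexx orbT.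
by apply: h1; rewrite le_max lexx.
Qed.

End Mu.
End Kappa.
End Regular.

(** * Strong colorings *)

Section Colorings.
Context {d : Order.disp_t} {O : bOrderType d} (wfO : well_ordered O).
Implicit Types (a b A B C D E X Y : set O).
Implicit Types (i j x y z mu nu sigma tau theta kappa alpha beta gamma delta eps xi zeta lambda : O).
Context (theta kappa : O) (reg_theta : infinite_regular theta)
  (reg_kappa : infinite_regular kappa) (lt_theta_kappa : theta < kappa).
Implicit Types (c : O -> O -> O).

Definition unbounded_in A : Prop :=
  A `<=` below kappa /\ forall xi, xi < kappa -> exists2 x, A x & xi < x.

(** Unlike [closed_coloring], this includes the supremum of [Dle c i beta]. *)
Definition strongly_closed c : Prop := forall i delta beta, i < theta ->
  delta < beta -> beta < kappa -> limit_of (Dle c i beta) delta -> c delta beta <= i.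

(** What U(kappa,2,theta,2) says about families of singletons. *)
Definition unbounded_coloring c : Prop := forall A, unbounded_in A ->
  forall i, i < theta -> exists alpha beta, [/\ A alpha, A beta, alpha < beta & i < c alpha beta].

Definition strong c : Prop :=
  [/\ coloring kappa theta c, subadditive kappa c, strongly_closed c & unbounded_coloring c].

Lemma subadditive_trans c i alpha beta gamma : subadditive kappa c ->
  alpha < beta -> beta < gamma -> gamma < kappa ->
  c alpha beta <= i -> c beta gamma <= i -> c alpha gamma <= i.
Proof.
move=> sc ab bg gk h1 h2; have [h _] := sc _ _ _ ab bg gk.
by apply: le_trans h _; rewrite ge_max h1.
Qed.

Lemma subadditive_down c i alpha beta gamma : subadditive kappa c ->
  alpha < beta -> beta < gamma -> gamma < kappa ->
  c alpha gamma <= i -> c beta gamma <= i -> c alpha beta <= i.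
Proof.
move=> sc ab bg gk h1 h2; have [_ h] := sc _ _ _ ab bg gk.
by apply: le_trans h _; rewrite ge_max h1.
Qed.

(** [R i alpha beta] is to be [c alpha beta <= i], so [c] is the least [i] at
    which the relation holds. *)
Lemma strong_of_relations (R : O -> O -> O -> Prop) :
  (forall i j alpha beta, alpha < beta -> beta < kappa -> i <= j -> j < theta ->
     R i alpha beta -> R j alpha beta) ->
  (forall alpha beta, alpha < beta -> beta < kappa -> exists2 i, i < theta & R i alpha beta) ->
  (forall i alpha beta gamma, i < theta -> alpha < beta -> beta < gamma -> gamma < kappa ->
     R i alpha beta -> R i beta gamma -> R i alpha gamma) ->
  (forall i alpha beta gamma, i < theta -> alpha < beta -> beta < gamma -> gamma < kappa ->
     R i alpha gamma -> R i beta gamma -> R i alpha beta) ->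
  (forall i delta beta, i < theta -> delta < beta -> beta < kappa ->
     limit_of [set alpha | R i alpha beta] delta -> R i delta beta) ->
  (forall A i, unbounded_in A -> i < theta ->
     ~ forall alpha beta, A alpha -> A beta -> alpha < beta -> R i alpha beta) ->
  exists c, strong c.
Proof.
move=> mono cover trans down closed unb.
pose c alpha beta := omin [set i | R i alpha beta].
have cmin alpha beta : alpha < beta -> beta < kappa ->
    c alpha beta < theta /\ R (c alpha beta) alpha beta.
  move=> ab bk; have [i it Ri] := cover _ _ ab bk.
  split; last exact: (@omin_mem _ _ wfO [set i | R i alpha beta] i).
  by apply: le_lt_trans it; apply: (@omin_le _ _ wfO [set i | R i alpha beta]).
have cR i alpha beta : i < theta -> alpha < beta -> beta < kappa ->
    c alpha beta <= i <-> R i alpha beta.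
  move=> it ab bk; have [ct cr] := cmin _ _ ab bk.
  by split=> [ci|Ri]; [exact: mono cr|exact: (@omin_le _ _ wfO [set i | R i alpha beta])].
exists c; split.
- by move=> alpha beta ab bk; have [] := cmin _ _ ab bk.
- move=> alpha beta gamma ab bg gk.
  have ag := lt_trans ab bg; have bk := lt_trans bg gk.
  have [t1 _] := cmin _ _ ab bk; have [t2 _] := cmin _ _ bg gk; have [t3 _] := cmin _ _ ag gk.
  split.
    set m := Order.max _ _; have mt : m < theta by rewrite gt_max t1.
    apply/cR => //; apply: (trans _ _ beta) => //; apply/cR => //; rewrite le_max lexx ?orbT //.
  set m := Order.max _ _; have mt : m < theta by rewrite gt_max t3.
  apply/cR => //; apply: (down _ _ _ gamma) => //; apply/cR => //; rewrite le_max lexx ?orbT //.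
- move=> i delta beta it db bk lim; apply/cR => //; apply: closed => //.
  apply: limit_of_sub lim => x xd [xb cx]; exact/cR.
- move=> A [Ak Au] i it; apply: contrapT => h; apply: (unb A i) => // alpha beta Aa Ab ab.
  apply/cR => //; first exact: Ak.
  by rewrite leNgt; apply/negP => ic; apply: h; exists alpha, beta.
Qed.

Lemma strong_closed_coloring c : strong c -> closed_coloring kappa theta c.
Proof.
move=> [col _ cl _] beta i bk it delta [ds lim].
have db : delta < beta.
  apply: lt_le_trans ds _; apply: osup_le => // _ [x [xb _] <-]; exact: succ_le.
split=> //; have [ti|ti] := leP theta i.
  by apply: le_trans ti; apply/ltW/col.
by apply: cl => //; apply/limit_of_osup.
Qed.

(** [a_ delta] is a member of the family above [delta], chosen [good] if
    possible, and [f delta] bounds those [Dle c i beta], [beta] in [a_ delta],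
    that are not cofinal in [delta].  On the positive set where [f] is constant,
    two good points [alpha < delta] have all values [c x y] above [i], since
    [c x y <= i] would put [x] below [f delta].  Two bad points have
    [c alpha delta <= i]: some [beta] in [a_ delta] has [c alpha beta <= i], and
    as [alpha] exceeds [f delta], also [c delta beta <= i]. *)
Lemma strong_witnesses_U c : strong c -> witnesses_U kappa kappa theta (osup (Reg kappa)) c.
Proof.
move=> [col sub cl unb]; split=> // sigma sS AA AAP triv AAk i it.
have [mu reg_mu smu] : exists2 mu, Reg kappa mu & sigma < mu.
  apply: contrapT => h; suff : osup (Reg kappa) <= sigma by rewrite leNgt sS.
  apply: osup_le => // mu mR; rewrite leNgt; apply/negP => sm; apply: h; by exists mu.
have [muk [_ cfmu]] := reg_mu.
have AAle tau : tau < kappa -> ~ (AA #<= below tau).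
  move=> tk AAt; apply: (regular_not_small wfO reg_kappa); exists tau => //.
  by move: AAk => /card_eqPle[_ h]; exact: card_le_trans AAt.
have above delta : delta < kappa -> exists2 a, AA a & forall x, a x -> delta < x.
  move=> dk; apply: contrapT => none; apply: (AAle _ (regular_succ wfO reg_kappa dk)).
  have /choice[r rP] : forall a, exists x, AA a -> a x /\ x <= delta.
    move=> a; have [Aa|nAa] := pselect (AA a); last by exists \bot.
    apply: contrapT => h; apply: none; exists a => // x ax.
    by rewrite ltNge; apply/negP => xd; apply: h; exists x.
  apply: (@fun_card_le _ _ _ _ r) => [a /rP[_ ra]|a b Aa Ab rab].
    exact: le_lt_trans ra (lt_succ wfO dk).
  apply: triv => //; exists (r a); split; first by have [] := rP _ Aa.
  by rewrite rab; have [] := rP _ Ab.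
have nonempty a : AA a -> a !=set0.
  move=> Aa; apply/set0P/eqP => a0.
  have [_ a_s] := AAP _ Aa.
  apply: (AAle (succ \bot)).
    by apply: regular_succ => //; apply: regular_gt0 reg_kappa.
  apply: (@fun_card_le _ _ _ _ (fun=> \bot)) => [b _|b b' Ab Ab' _].
    exact: lt_succ (regular_gt0 wfO reg_kappa).
  have E b'' : AA b'' -> b'' = set0.
    move=> /AAP[_ bs]; apply/eqP; rewrite -(@card_eq0 _ O).
    by apply: card_eq_trans bs _; rewrite card_eq_sym -a0.
  by rewrite (E _ Ab) (E _ Ab').
have asmall a : AA a -> small mu a.
  by move=> /AAP[_ /card_eqPle[h _]]; exists sigma.
pose good delta a := forall x, a x -> i < c delta x.
have /choice[a_ aP] : forall delta, exists a, delta < kappa -> [/\ AA a,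
    forall x, a x -> delta < x & (exists b, [/\ AA b, forall x, b x -> delta < x & good delta b]) ->
      good delta a].
  move=> delta; have [dk|] := pselect (delta < kappa); last by exists set0.
  have [[b [? ? ?]]|h] := pselect (exists b, [/\ AA b, forall x, b x -> delta < x & good delta b]).
    by exists b.
  by have [b] := above _ dk; exists b.
have /choice[h hP] : forall delta, exists eta, delta < kappa ->
    eta < kappa /\ forall x, a_ delta x -> x < eta.
  move=> delta; have [dk|] := pselect (delta < kappa); last by exists \bot.
  have [Aa _ _] := aP _ dk.
  have [||e ek eP] := @regular_bound _ _ wfO _ reg_kappa _ (a_ delta) id; last by exists e.
    by apply: small_mono (asmall _ Aa); exact: ltW.
  by have [] := AAP _ Aa.
have /choice[f fP] : forall delta, exists eps, delta < kappa -> cf delta = mu ->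
    eps < delta /\ forall beta, a_ delta beta -> ~ limit_of (Dle c i beta) delta ->
      forall alpha, c alpha beta <= i -> alpha < delta -> alpha < eps.
  move=> delta; have [dk|] := pselect (delta < kappa); last by exists \bot.
  have [cd|] := pselect (cf delta = mu); last by exists \bot.
  have [Aa da _] := aP _ dk.
  have d0 : \bot < delta by case: (cf_mu_limit wfO reg_mu cd).
  have /choice[g gP] : forall beta, exists xi, a_ delta beta -> xi < delta /\
      (~ limit_of (Dle c i beta) delta -> forall alpha, c alpha beta <= i ->
         alpha < delta -> alpha <= xi).
    move=> beta; have [ab|] := pselect (a_ delta beta); last by exists \bot.
    have [l|nl] := pselect (limit_of (Dle c i beta) delta); first by exists \bot.
    apply: contrapT => none; apply: nl; split=> // xi xid; apply: contrapT => none'.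
    apply: none; exists xi => _; split=> // _ alpha ca ad; rewrite leNgt; apply/negP => xa.
    by apply: none'; exists alpha; split=> //; split=> //; apply: lt_trans ad (da _ ab).
  have [||e ed eP] := @cf_bound _ _ wfO _ delta (a_ delta) g.
  - rewrite cd; exact: asmall.
  - by move=> beta /gP[].
  exists e => _ _; split=> // beta ab nl alpha ca ad.
  have [_ /(_ nl alpha ca ad) le] := gP _ ab; apply: le_lt_trans le _; exact: eP.
have hk xi : xi < kappa -> h xi < kappa by move=> /hP[].
have p0 := positive_closed hk (positive_full wfO reg_kappa reg_mu).
have [|eps ek p1] := fodor wfO reg_kappa (f := f) p0.
  by move=> delta dk cd _; have [] := fP _ dk cd.
pose S := [set delta | [/\ delta < kappa, cf delta = mu,
  forall xi, xi < delta -> h xi < delta & f delta = eps]].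
have Sfact delta : S delta -> eps < delta.
  by move=> [dk cd _ <-]; have [] := fP _ dk cd.
have : positive kappa mu ((S `&` [set delta | good delta (a_ delta)]) `|`
                          (S `&` [set delta | ~ good delta (a_ delta)])).
  apply: positive_sub p1 => delta dk cd [[_ cld] fd].
  by have [g|ng] := pselect (good delta (a_ delta)); [left|right].
move=> /(positive_or)[pg|pb].
  set T := S `&` _ in pg.
  have Tk : T `<=` below kappa by move=> delta [[]].
  have sep alpha delta x : T alpha -> T delta -> alpha < delta -> a_ alpha x -> x < delta.
    move=> [[ak _ _ _] _] [[dk _ cld _] _] ad ax.
    by have [_ hx] := hP _ ak; apply: lt_trans (hx _ ax) _; exact: cld.
  have abv delta x : T delta -> a_ delta x -> delta < x.
    by move=> [[dk _ _ _] _]; have [_ da _] := aP _ dk; exact: da.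
  have AAT delta : T delta -> AA (a_ delta).
    by move=> [[dk _ _ _] _]; have [] := aP _ dk.
  exists (a_ @` T); split.
  - by move=> _ [delta Td <-]; exact: AAT.
  - apply: (card_eq_trans (B := T)).
      have ne alpha delta : T alpha -> T delta -> alpha < delta -> a_ alpha <> a_ delta.
        move=> Ta Td ad E; have [x ax] := nonempty _ (AAT _ Ta).
        have := sep _ _ _ Ta Td ad ax; rewrite E in ax.
        by rewrite ltNge ltW // (abv _ _ Td ax).
      apply: inj_card_eq => alpha delta /set_mem Ta /set_mem Td E.
      case: (ltgtP alpha delta) => // [/(ne _ _ Ta Td)//|/(ne _ _ Td Ta)/(_ (esym E))//].
    apply: (unbounded_card wfO reg_kappa) => // xi xik.
    by have [delta [xd _ _ Td]] := positive_unbounded wfO reg_mu pg xik; exists delta.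
  - move=> _ _ [alpha Ta <-] [delta Td <-] slt.
    have [x0 ax0] := nonempty _ (AAT _ Ta).
    have [y0 ay0] := nonempty _ (AAT _ Td).
    have ad : alpha < delta.
      case: (ltgtP alpha delta) => // [da|E].
        have := sep _ _ _ Td Ta da ay0; rewrite ltNge ltW //.
        exact: lt_trans (abv _ _ Ta ax0) (slt _ _ ax0 ay0).
      by rewrite E in ax0; have := slt x0 x0; rewrite E ltxx => /(_ ax0 ax0).
    have : [set c x y | x in a_ alpha & y in a_ delta] (c x0 y0) by exists x0 => //; exists y0.
    move=> /(omin_mem wfO) [x ax [y ay <-]].
    rewrite ltNge; apply/negP => cxy.
    have [[dk cd cld fd] gd] := Td.
    have [_ fd'] := fP _ dk cd.
    have yk : y < kappa by have [Ad _] := AAP _ (AAT _ Td); exact: Ad.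
    have := fd' y ay _ x cxy (sep _ _ _ Ta Td ad ax).
    rewrite fd ltNge ltW; last first.
      by apply: lt_trans (abv _ _ Ta ax); apply: Sfact; case: Ta.
    move=> bad; suff : false by []; apply: bad => lim.
    have := gd _ ay; rewrite ltNge cl //; exact: abv.
exfalso; set T := S `&` _ in pb.
have [|alpha [delta [Ta Td ad]]] := unb T _ i it.
  split=> [delta [[]]//|xi xik].
  by have [delta [xd _ _ Td]] := positive_unbounded wfO reg_mu pb xik; exists delta.
rewrite ltNge; apply/negP/negPn.
have [[ak ca cla fa] nga] := Ta; have [[dk cd cld fd] ngd] := Td.
have [Aa abvd _] := aP _ dk.
have [beta [ab cb]] : exists beta, a_ delta beta /\ c alpha beta <= i.
  apply: contrapT => none; apply: nga; have [_ _] := aP _ ak; apply.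
  exists (a_ delta); split=> // [x /abvd|x ax]; first exact: lt_trans ad.
  by rewrite ltNge; apply/negP => cx; apply: none; exists x.
have bk : beta < kappa by have [Ad _] := AAP _ Aa; exact: Ad.
have db := abvd _ ab.
apply: (subadditive_down sub ad db bk) => //.
apply: cl => //; apply: contrapT => nl.
have [_ fd'] := fP _ dk cd.
have := fd' _ ab nl _ cb ad; rewrite fd ltNge ltW //; apply: Sfact; by case: Ta.
Qed.

Lemma witnesses_U_two chi c : succ (succ \bot) <= chi ->
  witnesses_U kappa kappa theta chi c -> witnesses_U kappa (succ (succ \bot)) theta (succ (succ \bot)) c.
Proof.
move=> chi2 [col H]; split=> // sigma s2 AA AAP triv AAk i it.
have [BB [BA BBk BBP]] := H _ (lt_le_trans s2 chi2) _ AAP triv AAk _ it.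
have k0 := regular_gt0 wfO reg_kappa; have k1 := regular_succ wfO reg_kappa k0.
have lt01 : \bot < succ (\bot : O) by exact: lt_succ k0.
have lt12 : succ (\bot : O) < succ (succ \bot) by exact: lt_succ k1.
have [f [fB finj]] : exists f : O -> set O, (forall x, below kappa x -> BB (f x)) /\
    forall x y, below kappa x -> below kappa y -> f x = f y -> x = y.
  by apply: (card_le_fun set0); have /card_eqPle[] := BBk.
have below2 x : x < succ (succ (\bot : O)) -> x = \bot \/ x = succ \bot.
  move=> x2; have := lt_succ_le wfO x2; rewrite le_eqVlt => /orP[/eqP|x1]; first by right.
  by left; apply/eqP; rewrite -lex0; exact: lt_succ_le x1.
exists (f @` below (succ (succ \bot))); split.
- move=> _ [x x2 <-]; apply: BA; apply: fB; apply: lt_trans x2 _; exact: regular_succ.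
- apply: inj_card_eq => x y /set_mem x2 /set_mem y2.
  have k2 := regular_succ wfO reg_kappa k1.
  by apply: finj; [exact: lt_trans k2|exact: lt_trans k2].
- move=> _ _ [x x2 <-] [y y2 <-]; apply: BBP; apply: fB;
  [apply: lt_trans x2 _|apply: lt_trans y2 _]; exact: regular_succ.
Qed.

Lemma witnesses_U_unbounded c :
  witnesses_U kappa (succ (succ \bot)) theta (succ (succ \bot)) c -> unbounded_coloring c.
Proof.
move=> [col H] A [Ak Au] i it.
have k0 := regular_gt0 wfO reg_kappa; have k1 := regular_succ wfO reg_kappa k0.
have lt01 : \bot < succ (\bot : O) by exact: lt_succ k0.
have lt12 : succ (\bot : O) < succ (succ \bot) by exact: lt_succ k1.
have [|||BB [BA BB2 BBP]] := H (succ \bot) lt12 [set [set x] | x in A] _ _ _ i it.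
- move=> _ [x Ax <-]; split=> [_ ->|]; first exact: Ak.
  apply: (@fun_card_eq _ _ _ _ (fun=> \bot)) => [_ _|y z -> ->|y y1] //.
  exists x => //; apply/esym/eqP; rewrite -lex0; exact: lt_succ_le y1.
- by move=> _ _ [x Ax <-] [y Ay <-] [z [-> ->]].
- apply: (card_eq_trans (B := A)); last exact: unbounded_card.
  apply: inj_card_eq => x y _ _ E; have : [set x] x by [].
  by rewrite E.
have [f [fB finj]] : exists f : O -> set O, (forall x, below (succ (succ \bot)) x -> BB (f x)) /\
    forall x y, below (succ (succ \bot)) x -> below (succ (succ \bot)) y -> f x = f y -> x = y.
  by apply: (card_le_fun set0); have /card_eqPle[] := BB2.
have h0 := fB \bot (lt_trans lt01 lt12); have h1 := fB (succ \bot) lt12.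
have ne : f \bot <> f (succ \bot).
  move=> /finj; move=> /(_ (lt_trans lt01 lt12) lt12) E; by rewrite -E ltxx in lt01.
have [x Ax E0] := BA _ h0; have [y Ay E1] := BA _ h1.
have key x' y' : A x' -> A y' -> BB [set x'] -> BB [set y'] -> x' < y' ->
    exists alpha beta, [/\ A alpha, A beta, alpha < beta & i < c alpha beta].
  move=> Ax' Ay' Bx By xy; exists x', y'; split=> //.
  have := BBP _ _ Bx By; rewrite (_ : [set c _ _ | _ in _ & _ in _] = [set c x' y']).
    rewrite (@omin_eq _ _ [set c x' y'] (c x' y')) //; last by move=> _ ->.
    by apply=> _ _ -> ->.
  apply/seteqP; split=> [_ [_ -> [_ -> <-]]|_ ->] //; by exists x' => //; exists y'.
case: (ltgtP x y) => [xy|yx|E].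
- by apply: key xy; rewrite ?E0 ?E1.
- by apply: key yx; rewrite ?E0 ?E1.
- by case: ne; rewrite -E0 -E1 E.
Qed.

End Colorings.

(** * Matrices and colorings *)

Section Matrices.
Context {d : Order.disp_t} {O : bOrderType d} (wfO : well_ordered O).
Implicit Types (a b A B C D E X Y : set O).
Implicit Types (i j x y z mu nu sigma tau alpha beta gamma delta eps xi zeta lambda : O).
Context (theta kappa : O) (reg_theta : infinite_regular theta)
  (reg_kappa : infinite_regular kappa) (lt_theta_kappa : theta < kappa).
Implicit Types (c : O -> O -> O).

Lemma limit_of_initial A beta delta : delta <= beta ->
  limit_of (A `&` below beta) delta <-> limit_of A delta.
Proof.
move=> db; split; apply: limit_of_sub => x xd; first by case.
by move=> Ax; split=> //; exact: lt_le_trans xd db.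
Qed.

Lemma acc_initial A beta delta kappa' : A `<=` below kappa' ->
  acc (A `&` below beta) delta <-> acc A delta /\ delta < beta.
Proof.
move=> Ak; rewrite (accP wfO (kappa := kappa')); last by move=> x [/Ak].
rewrite (accP wfO (kappa := kappa')) //; split=> [[[Ad db] l]|[[Ad l] db]].
  by split=> //; split=> //; apply/(limit_of_initial _ (ltW db)).
by split=> //; apply/(limit_of_initial _ (ltW db)).
Qed.

Lemma club_tail xi : xi < kappa -> club [set x | xi < x /\ x < kappa] kappa.
Proof.
move=> xik; apply/(clubP wfO _ (regular_gt0 wfO reg_kappa)); split=> [x []//|gamma gk|].
  move=> [g0 h]; split=> //; have [x [[xix _] _ xg]] := h _ g0; exact: lt_trans xg.
have [k0 h] := regular_limit wfO reg_kappa; split=> // zeta zk.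
have mk : Order.max xi zeta < kappa by rewrite gt_max xik.
by have [x [_ + xk]] := h _ mk; rewrite gt_max => /andP[xix zx]; exists x.
Qed.

(** The relation compares the next members of [Gamma].  It is closed, as a limit
    of points of [acc (C gamma i)] lies in [acc (C gamma i)] and hence in
    [Gamma]. *)
Theorem boxminus_strong : boxminus_ind kappa theta -> exists c, strong theta kappa c.
Proof.
move=> [Gamma [iota [C [[_ Gacc] Gcol coh guess]]]].
have Glim alpha : Gamma alpha -> alpha < kappa /\ limit alpha by move=> /Gacc/(acc_belowP wfO).
have Gunb xi : xi < kappa -> exists2 alpha, Gamma alpha & xi < alpha.
  move=> xik; have [alpha [aD Ga] _] := guess _ (club_tail xik).
  by exists alpha => //; case: aD => -[].
have G0 alpha : Gamma alpha -> \bot < alpha by move=> /Glim[_ []].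
have Csub alpha i : Gamma alpha -> iota alpha <= i -> i < theta -> C alpha i `<=` below alpha.
  by move=> Ga ia it; have [_ h _ _] := Gcol _ Ga; have [[? _] _] := h _ ia it.
have Ccl alpha i : Gamma alpha -> iota alpha <= i -> i < theta -> forall gamma,
    gamma < alpha -> limit_of (C alpha i) gamma -> C alpha i gamma.
  move=> Ga ia it; have [_ h _ _] := Gcol _ Ga.
  by have /(clubP wfO _ (G0 _ Ga))[] := h _ ia it.
have Cunb alpha i : Gamma alpha -> iota alpha <= i -> i < theta -> limit_of (C alpha i) alpha.
  move=> Ga ia it; have [_ h _ _] := Gcol _ Ga.
  by have /(clubP wfO _ (G0 _ Ga))[] := h _ ia it.
have CaccP alpha i x : Gamma alpha -> iota alpha <= i -> i < theta ->
    acc (C alpha i) x <-> C alpha i x /\ limit_of (C alpha i) x.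
  by move=> Ga ia it; apply: accP (Csub _ _ Ga ia it).
have CG alpha i x : Gamma alpha -> iota alpha <= i -> i < theta ->
    acc (C alpha i) x -> Gamma x /\ x < alpha.
  move=> Ga ia it ax; have [_ _ _ E] := Gcol _ Ga.
  by have : (Gamma `&` below alpha) x by rewrite E; exists i.
pose nxt beta := omin [set gamma | Gamma gamma /\ beta <= gamma].
have nP beta : beta < kappa -> [/\ Gamma (nxt beta), beta <= nxt beta &
    forall gamma, Gamma gamma -> beta <= gamma -> nxt beta <= gamma].
  move=> bk; have [g Gg bg] := Gunb _ bk.
  have /(omin_mem wfO)[h1 h2] : [set gamma | Gamma gamma /\ beta <= gamma] g by split=> //; exact: ltW.
  by split=> // gamma Gg' bg'; apply: omin_le.
have nmono alpha beta : alpha <= beta -> beta < kappa -> nxt alpha <= nxt beta.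
  move=> ab bk; have [Gb bb _] := nP _ bk; have [_ _] := nP _ (le_lt_trans ab bk).
  by apply=> //; exact: le_trans bb.
have tr i x y z : i < theta -> Gamma z -> iota z <= i -> acc (C z i) y ->
    iota y <= i /\ (acc (C y i) x <-> acc (C z i) x /\ x < y).
  move=> it Gg ig ab; have [ib E] := coh _ _ _ Gg ig it ab.
  split=> //; rewrite E; exact: acc_initial (Csub _ _ Gg ig it).
pose R i alpha beta := nxt alpha = nxt beta \/
  iota (nxt beta) <= i /\ acc (C (nxt beta) i) (nxt alpha).
apply: (@strong_of_relations _ _ wfO theta kappa R).
- move=> i j alpha beta ab bk ij jt [E|[ib aa]]; [by left|right].
  have [Gb _ _] := nP _ bk; have it := le_lt_trans ij jt.
  split; first exact: le_trans ij.
  have [Ca la] := (CaccP _ _ _ Gb ib it).1 aa.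
  have [_ _ inc _] := Gcol _ Gb.
  apply/CaccP => //; first exact: le_trans ij.
  split; first exact: inc Ca.
  apply: limit_of_sub la => x _; exact: inc.
- move=> alpha beta ab bk; have [Gb _ _] := nP _ bk; have [Ga _ _] := nP _ (lt_trans ab bk).
  have := nmono _ _ (ltW ab) bk; rewrite le_eqVlt => /orP[/eqP E|nab].
    by exists \bot; [exact: regular_gt0 reg_theta|left].
  have [_ _ _ E] := Gcol _ Gb.
  have : (Gamma `&` below (nxt beta)) (nxt alpha) by [].
  by rewrite E => -[i [/= ib it] aa]; exists i => //; right.
- move=> i alpha beta gamma it ab bg gk [Eab|[ib aab]]; first by rewrite /R Eab.
  move=> [Ebg|[ig abg]]; first by rewrite /R -Ebg; right.
  have [Gg _ _] := nP _ gk; have [_ h] := tr i (nxt alpha) _ _ it Gg ig abg.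
  by right; split=> //; have [] := h.1 aab.
- move=> i alpha beta gamma it ab bg gk Rag Rbg.
  have bk := lt_trans bg gk.
  have := nmono _ _ (ltW ab) bk; rewrite le_eqVlt => /orP[/eqP E|nab]; first by left.
  have nbg := nmono _ _ (ltW bg) gk.
  case: Rag => [E|[ig aag]]; first by move: nab; rewrite E ltNge nbg.
  case: Rbg => [E|[_ abg]]; first by rewrite /R E; right.
  have [Gg _ _] := nP _ gk; have [ib h] := tr i (nxt alpha) _ _ it Gg ig abg.
  by right; split=> //; apply/h.
- move=> i delta beta it db bk lim.
  have dk := lt_trans db bk.
  have [Gb _ _] := nP _ bk; have [Gd dd dmin] := nP _ dk.
  have := nmono _ _ (ltW db) bk; rewrite le_eqVlt => /orP[/eqP E|ndb]; first by left.
  have [d0 lim'] := lim.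
  have accb alpha : alpha < delta -> R i alpha beta ->
      iota (nxt beta) <= i /\ acc (C (nxt beta) i) (nxt alpha).
    move=> ad [E|//]; have := nmono _ _ (ltW ad) dk.
    by rewrite E leNgt ndb.
  have [x0 [Rx0 _ x0d]] := lim' _ d0.
  have [ib _] := accb _ x0d Rx0.
  right; split=> //.
  have [[x1 [x1d Rx1 nx1]]|allbelow] := pselect (exists x1, [/\ x1 < delta, R i x1 beta & delta <= nxt x1]).
    have [_ aa] := accb _ x1d Rx1.
    have [G1 _ _] := nP _ (lt_trans x1d dk).
    suff -> : nxt delta = nxt x1 by [].
    by apply/eqP; rewrite eq_le dmin //= nmono // ltW.
  have limC : limit_of (acc (C (nxt beta) i)) delta.
    split=> // xi /lim'[alpha [Ra xia ad]]; exists (nxt alpha).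
    have [_ aa] := accb _ ad Ra; split=> //.
      by have [_ h _] := nP _ (lt_trans ad dk); exact: lt_le_trans h.
    by rewrite ltNge; apply/negP => dn; apply: allbelow; exists alpha.
  have limC' : limit_of (C (nxt beta) i) delta.
    by apply: limit_of_sub limC => x _ [].
  have Cd : C (nxt beta) i delta by apply: Ccl => //; exact: le_lt_trans ndb.
  have ad : acc (C (nxt beta) i) delta by apply/CaccP.
  suff -> : nxt delta = delta by [].
  have [Gdelta _] := CG _ _ _ Gb ib it ad.
  by apply/eqP; rewrite eq_le dd dmin.
- move=> A i [Ak Au] it Rall.
  (* the points of [nxt @` A] form a chain, and their levels cohere to a thread *)
  pose B := nxt @` A.
  have BG z : B z -> Gamma z by move=> [w /Ak ak <-]; have [] := nP _ ak.
  have Bk z : B z -> z < kappa by move=> /BG/Glim[].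
  have Bunb xi : xi < kappa -> exists2 z, B z & xi < z.
    move=> /Au[w Aa xia]; exists (nxt w); first by exists w.
    by have [_ h _] := nP _ (Ak _ Aa); exact: lt_le_trans h.
  have Bacc z z' : B z -> B z' -> z < z' -> iota z' <= i /\ acc (C z' i) z.
    move=> [w Aa <-] [w' Aa' <-] nab.
    have aa' : w < w'.
      by rewrite ltNge; apply/negP => /nmono/(_ (Ak _ Aa)); rewrite leNgt nab.
    by have [E|] := Rall _ _ Aa Aa' aa'; first by rewrite E ltxx in nab.
  have Biota z : B z -> iota z <= i.
    move=> Bb; have [z' Bb' bb'] := Bunb _ (Bk _ Bb).
    have [ib' ab] := Bacc _ _ Bb Bb' bb'.
    by have [] := tr i \bot _ _ it (BG _ Bb') ib' ab.
  have BC z z' : B z -> B z' -> z < z' -> C z i = C z' i `&` below z.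
    move=> Bb Bb' bb'; have [ib' ab] := Bacc _ _ Bb Bb' bb'.
    by have [] := coh _ _ _ (BG _ Bb') ib' it ab.
  pose D := [set x | exists z, B z /\ C z i x].
  have DB z : B z -> D `&` below z = C z i.
    move=> Bb; apply/seteqP; split=> [x [[z' [Bb' Cx]] xb]|x Cx]; last first.
      by split; [exists z|apply: Csub Cx => //; [exact: BG|exact: Biota]].
    case: (ltgtP z z') => [bb'|z'z|->//]; first by rewrite (BC _ _ Bb Bb' bb').
    by have : C z' i x by []; rewrite (BC _ _ Bb' Bb z'z) => -[].
  have Dlim xi z : B z -> xi <= z -> limit_of D xi <-> limit_of (C z i) xi.
    by move=> Bb xib; rewrite -(DB _ Bb) (limit_of_initial _ xib).
  have Dclub : club D kappa.
    apply/(clubP wfO _ (regular_gt0 wfO reg_kappa)); split.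
    - move=> x [z [Bb Cx]]; have xb : x < z by apply: Csub Cx => //; [exact: BG|exact: Biota].
      exact: lt_trans (Bk _ Bb).
    - move=> g gk lg; have [z Bb gb] := Bunb _ gk.
      exists z; split=> //; apply: Ccl => //; [exact: BG|exact: Biota|].
      by apply/(Dlim _ z) => //; exact: ltW.
    - split=> [|xi xik]; first exact: regular_gt0 reg_kappa.
      have [z Bb xib] := Bunb _ xik.
      have [_ /(_ _ xib)[x [Cx xix xb]]] := Cunb _ _ (BG _ Bb) (Biota _ Bb) it.
      by exists x; split=> //; [exists z|exact: lt_trans (Bk _ Bb)].
  have [alpha [aD Ga] bad] := guess _ Dclub.
  have [ak _] := Glim _ Ga; have [z Bb ab] := Bunb _ ak.
  have abC : acc (C z i) alpha.
    rewrite -(DB _ Bb); apply/(@acc_initial D z alpha kappa) => //.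
    by case: Dclub => -[].
  have [ia E] := coh _ _ _ (BG _ Bb) (Biota _ Bb) it abC.
  apply: (bad i ia it); rewrite E -(DB _ Bb) -setIA; congr (D `&` _).
  by apply/seteqP; split=> [x xa|x []//]; split=> //; exact: lt_trans ab.
Qed.

Definition reached c : set O :=
  [set alpha | alpha < kappa /\ exists2 i, i < theta & limit_of (Dle c i alpha) alpha].

Definition reached_often c : Prop := forall D, club D kappa -> forall xi, xi < kappa ->
  exists alpha, [/\ xi < alpha, limit_of D alpha & reached c alpha].

(** For [cf alpha < theta], a short cofinal set gets boundedly many colors; for
    [cf alpha > theta], one of the [theta] sets [Dle c i alpha] whose union is
    [alpha] must be cofinal. *)
Lemma reached_cf c alpha : coloring kappa theta c ->
  alpha < kappa -> limit alpha -> cf alpha <> theta -> reached c alpha.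
Proof.
move=> col ak lima cfa; split=> //; have [a0 aa] := lima; case: (ltgtP (cf alpha) theta) => // [cft|tcf].
  have [a [asub acof] /card_eqPle[aeq _]] := cf_cofinal wfO alpha.
  have [||i it iP] := @regular_bound _ _ wfO _ reg_theta _ a (c ^~ alpha).
  - by exists (cf alpha).
  - by move=> x /asub xa; apply: col.
  exists i => //; split=> // xi xia.
  have [y ay sy] := acof _ (limit_succ wfO lima xia).
  exists y; split; last exact: asub.
  - by split; [exact: asub|exact/ltW/iP].
  - exact: lt_le_trans (lt_succ wfO xia) sy.
apply: contrapT => none.
have /choice[bd bP] : forall i, exists bd, i < theta ->
    bd < alpha /\ forall x, Dle c i alpha x -> x <= bd.
  move=> i; have [it|nit] := pselect (i < theta); last by exists \bot.
  apply: contrapT => h; apply: none; exists i => //; split=> // xi xia.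
  apply: contrapT => h'; apply: h; exists xi => _; split=> // x Dx; rewrite leNgt.
  by apply/negP => xix; apply: h'; exists x; split=> //; case: Dx.
have [||e ea eP] := @cf_bound _ _ wfO _ alpha (below theta) bd.
- exact: small_below.
- by move=> i /bP[].
have [_ /(_ e (conj ea (lexx _)))] := bP _ (col _ _ ea ak).
by rewrite leNgt (eP _ (col _ _ ea ak)).
Qed.

(** If a club [D] were guessed at each point of [reached c] by some level, then
    one level would do so unboundedly often, and [c] would be bounded by it on
    those points. *)
Theorem boxminus_of_coloring c : coloring kappa theta c -> subadditive kappa c ->
  closed_coloring kappa theta c -> unbounded_coloring theta kappa c ->
  reached_often c -> boxminus_ind kappa theta.
Proof.
move=> col sub cl unb often.
pose iota alpha := omin [set i | limit_of (Dle c i alpha) alpha].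
have Dmono i j alpha x : i <= j -> Dle c i alpha x -> Dle c j alpha x.
  by move=> ij [xa ci]; split=> //; exact: le_trans ij.
have iotaP alpha i : reached c alpha -> iota alpha <= i -> limit_of (Dle c i alpha) alpha.
  move=> [ak [j jt lj]] ai.
  have : limit_of (Dle c (iota alpha) alpha) alpha.
    exact: (@omin_mem _ _ wfO [set i | limit_of (Dle c i alpha) alpha] j).
  by apply: limit_of_sub => x _; apply: Dmono.
have iota_le alpha i : limit_of (Dle c i alpha) alpha -> iota alpha <= i.
  exact: (@omin_le _ _ wfO [set i | limit_of (Dle c i alpha) alpha]).
have Drestr i alpha beta : alpha < kappa -> Dle c i alpha beta ->
    Dle c i beta = Dle c i alpha `&` below beta.
  move=> ak [ba cb]; apply/seteqP; split=> [x [xb cx]|x [[xa cx] xb]].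
    by split=> //; split; [exact: lt_trans ba|exact: (subadditive_trans sub xb ba ak)].
  by split=> //; exact: (subadditive_down sub xb ba ak).
have Dsub i alpha : Dle c i alpha `<=` below alpha by move=> x [].
have accD i alpha x : acc (Dle c i alpha) x <-> Dle c i alpha x /\ limit_of (Dle c i alpha) x.
  exact: accP (Dsub i alpha).
have accG i alpha x : alpha < kappa -> i < theta -> acc (Dle c i alpha) x ->
    [/\ x < alpha, reached c x & iota x <= i].
  move=> ak it /accD[Dx lx]; have xa : x < alpha by case: Dx.
  have lx' : limit_of (Dle c i x) x by rewrite (Drestr _ _ _ ak Dx) limit_of_initial.
  by split=> //; [split; [exact: lt_trans ak|exists i]|exact: iota_le].
exists (reached c), iota, (fun alpha i => Dle c i alpha); split.
- split=> [alpha [[ak cfa] /(acc_belowP wfO)[_ lima]]|alpha [ak [i it l]]].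
    exact: reached_cf.
  by apply/(acc_belowP wfO); split=> //; exact: limit_of_limit l.
- move=> alpha Ga; have [ak [i0 i0t l0]] := Ga; have [a0 _] := l0.
  have it0 : iota alpha < theta by apply: le_lt_trans i0t; exact: iota_le.
  split=> //.
  + move=> i ai it; apply/(clubP wfO _ a0); split=> //; last exact: iotaP.
    move=> g ga lg; apply: cl => //; first exact: ltW.
    split; last exact/limit_of_osup.
    have [_ /(_ _ ga)[x [Dx gx xa]]] := iotaP _ _ Ga ai.
    apply: (lt_trans gx); apply: lt_le_trans (lt_succ wfO xa) _.
    apply: (@le_osup _ _ wfO _ alpha); last by exists x.
    by move=> _ [y [ya _] <-]; exact: succ_le.
  + by move=> i j _ ij jt x; apply: Dmono.
  + apply/seteqP; split=> [x [Gx xa]|x [i [_ it] /(accG _ _ _ ak it)[]]] //.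
    have [_ [j jt lj]] := Gx.
    pose m := Order.max (iota alpha) (Order.max (iota x) (c x alpha)).
    have ix : iota x < theta by apply: le_lt_trans jt; exact: iota_le.
    exists m.
      split; first by rewrite le_max lexx.
      by rewrite /= !gt_max it0 ix col.
    have Dx : Dle c m alpha x by split=> //; rewrite !le_max lexx !orbT.
    apply/accD; split=> //.
    have : limit_of (Dle c m x) x by apply: iotaP => //; rewrite !le_max lexx !orbT.
    by rewrite (Drestr _ _ _ ak Dx) limit_of_initial.
- move=> alpha i x [ak _] ai it ax; have [xa Gx ix] := accG _ _ _ ak it ax.
  by split=> //; apply: Drestr => //; have /accD[] := ax.
- move=> D clubD; apply: contrapT => none.
  have clD := (clubP wfO D (regular_gt0 wfO reg_kappa)).1 clubD.
  have [Dk Dcl _] := clD.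
  have /choice[lev levP] : forall alpha, exists i, limit_of D alpha -> reached c alpha ->
      i < theta /\ D `&` below alpha = Dle c i alpha.
    move=> alpha; have [lD|?] := pselect (limit_of D alpha); last by exists \bot.
    have [Ga|?] := pselect (reached c alpha); last by exists \bot.
    apply: contrapT => h; apply: none; exists alpha.
      by split=> //; apply/(accP wfO _ Dk); split=> //; apply: Dcl => //; case: Ga.
    by move=> i ai it E; apply: h; exists i.
  pose A i := [set alpha | [/\ limit_of D alpha, reached c alpha & lev alpha = i]].
  have [i it Ai] : exists2 i, i < theta & unbounded_in kappa (A i).
    apply: contrapT => h.
    have /choice[bd bP] : forall i, exists bd, i < theta -> bd < kappa /\
        forall alpha, A i alpha -> alpha <= bd.
      move=> i; have [it|?] := pselect (i < theta); last by exists \bot.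
      apply: contrapT => h'; apply: h; exists i => //; split=> [alpha [_ []]//|xi xik].
      apply: contrapT => h''; apply: h'; exists xi => _; split=> // alpha Aa.
      by rewrite leNgt; apply/negP => xa; apply: h''; exists alpha.
    have [||e ek eP] := @regular_bound _ _ wfO _ reg_kappa _ (below theta) bd.
    - exact: small_below.
    - by move=> i /bP[].
    have [alpha [ea lD Ga]] := often _ clubD _ ek.
    have [lt _] := levP _ lD Ga.
    have Aa : A (lev alpha) alpha by [].
    have [_ /(_ alpha Aa)] := bP _ lt.
    by rewrite leNgt (lt_trans (eP _ lt) ea).
  have [alpha [beta [[la Ga _] [lb Gb lev_b] ab]]] := unb _ Ai _ it.
  have [_ E] := levP _ lb Gb.
  have : Dle c (lev beta) beta alpha.
    by rewrite -E; split=> //; apply: Dcl => //; case: Ga.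
  by rewrite lev_b => -[_]; rewrite leNgt => /negP.
Qed.

Lemma reached_often_Reg c mu : coloring kappa theta c -> Reg kappa mu -> mu <> theta ->
  reached_often c.
Proof.
move=> col reg_mu mut D /(clubP wfO _ (regular_gt0 wfO reg_kappa))[Dk _ [_ Dl]] xi xik.
have [x|x|delta [xd dk cd lD _]] := common_limits wfO reg_kappa reg_mu (A := D) (B := D) _ _ xik.
- by move=> /Dl.
- by move=> /Dl.
have limd := cf_mu_limit wfO reg_mu cd.
by exists delta; split=> //; apply: reached_cf => //; rewrite cd.
Qed.

End Matrices.

(** * Walks along a C-sequence *)

Section Walks.
Context {d : Order.disp_t} {O : bOrderType d} (wfO : well_ordered O).
Implicit Types (A B D E X Y : set O).
Implicit Types (i j x y z mu nu sigma tau alpha beta gamma delta eps xi zeta lambda : O).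
Context (theta kappa : O) (reg_theta : infinite_regular theta) (lt_theta_kappa : theta < kappa).

(** [acc (C beta)], for [C beta] bounded. *)
Definition accC (C : O -> set O) beta lambda : Prop := C beta lambda /\ limit_of (C beta) lambda.

Definition coherent (C : O -> set O) beta : Prop :=
  forall lambda, accC C beta lambda -> C lambda = C beta `&` below lambda.

(** A C-sequence whose members are either coherent or small. *)
Record walkable (C : O -> set O) : Prop := Walkable {
  walk_below : forall beta, beta < kappa -> C beta `<=` below beta;
  walk_cofinal : forall alpha beta, alpha < beta -> beta < kappa ->
    exists2 x, C beta x & alpha <= x;
  walk_closed : forall beta gamma, beta < kappa -> gamma < beta ->
    limit_of (C beta) gamma -> C beta gamma;
  walk_small : forall beta, beta < kappa -> ~ coherent C beta -> small theta (C beta) }.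

Context (C : O -> set O) (Cw : walkable C).

Lemma accC_initial gamma lambda mu : coherent C gamma -> accC C gamma lambda ->
  accC C lambda mu <-> accC C gamma mu /\ mu < lambda.
Proof.
move=> co al; rewrite /accC (co _ al); split=> [[[Cm ml] l]|[[Cm l] ml]].
  by split=> //; split=> //; move: l; rewrite limit_of_initial // ltW.
by split=> //; rewrite limit_of_initial // ltW.
Qed.

Lemma coherent_acc gamma lambda : coherent C gamma -> accC C gamma lambda -> coherent C lambda.
Proof.
move=> co al mu am; have [am' ml] := (accC_initial mu co al).1 am.
rewrite (co _ am') (co _ al) -setIA; congr (C gamma `&` _).
by apply/seteqP; split=> [x xm|x []//]; split=> //; exact: lt_trans ml.
Qed.

Context (M : O -> O) (M_theta : forall beta, beta < kappa -> M beta < theta)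
  (M_acc : forall gamma lambda, gamma < kappa -> coherent C gamma -> accC C gamma lambda ->
     M lambda <= M gamma).

(** The first step of the walk from [beta] down to [alpha]. *)
Definition nxt alpha beta : O := omin [set x | C beta x /\ alpha <= x].

(** For a coherent [C beta], the part of [C beta `&` below alpha] starting at
    the last limit point of [C beta] up to [alpha]; it is finite.  Otherwise all of
    [C beta `&` below alpha], which is small. *)
Definition tail alpha beta : set O := [set xi | [/\ C beta xi, xi < alpha &
  coherent C beta -> forall lambda, accC C beta lambda -> lambda <= alpha -> lambda <= xi]].

(** Level [i] of the tree orderings.  A walk from [beta] to [alpha] is recorded
    together with walks from [alpha] to the points of [C beta] that it leaves
    behind, as in Todorcevic's recursion for rho.  For an incoherent [beta], all
    pairs from [C beta] have to be at level [i], which is what [walk_limit] needs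
    at the limit points of [C beta]. *)
Inductive walk i : O -> O -> Prop :=
| walk_refl alpha : walk i alpha alpha
| walk_step alpha beta : alpha < beta -> M beta <= i ->
    (~ coherent C beta -> forall xi zeta, C beta xi -> C beta zeta -> xi < zeta -> walk i xi zeta) ->
    walk i alpha (nxt alpha beta) ->
    (forall xi, tail alpha beta xi -> walk i xi alpha) ->
    walk i alpha beta.

Lemma walk_inv i alpha beta : alpha < beta -> walk i alpha beta ->
  [/\ M beta <= i,
    ~ coherent C beta -> forall xi zeta, C beta xi -> C beta zeta -> xi < zeta -> walk i xi zeta,
    walk i alpha (nxt alpha beta) &
    forall xi, tail alpha beta xi -> walk i xi alpha].
Proof. by move=> + H; case: H => [a|a b *]; [rewrite ltxx|split]. Qed.

Lemma walk_mono i j alpha beta : i <= j -> walk i alpha beta -> walk j alpha beta.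
Proof.
move=> ij; elim=> [a|a b ab Mb _ IH1 _ IH2 _ IH3]; first exact: walk_refl.
by apply: walk_step => //; exact: le_trans ij.
Qed.

Lemma nxtP alpha beta : alpha < beta -> beta < kappa ->
  [/\ C beta (nxt alpha beta), alpha <= nxt alpha beta, nxt alpha beta < beta &
    forall x, C beta x -> alpha <= x -> nxt alpha beta <= x].
Proof.
move=> ab bk; have [x Cx ax] := walk_cofinal Cw ab bk.
have [Cn an] : [set x | C beta x /\ alpha <= x] (nxt alpha beta) by apply: (omin_mem wfO (x := x)).
split=> //; first exact: walk_below Cn.
by move=> y Cy ay; apply: omin_le.
Qed.

Lemma nxt_eq alpha beta x : C beta x -> alpha <= x ->
  (forall y, C beta y -> alpha <= y -> x <= y) -> nxt alpha beta = x.
Proof. by move=> Cx ax h; apply: omin_eq => // y []; exact: h. Qed.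

(** As [C lambda] is an initial segment of [C gamma], the walks from [gamma] and
    from [lambda] to [alpha] have the same first step and the same tail. *)
Lemma walk_acc i alpha gamma lambda : gamma < kappa -> coherent C gamma ->
  accC C gamma lambda -> alpha < lambda ->
  walk i alpha gamma <-> M gamma <= i /\ walk i alpha lambda.
Proof.
move=> gk co al a_l.
have [Cl [l0 ll]] := al; have lg : lambda < gamma := walk_below Cw gk Cl.
have ag := lt_trans a_l lg; have lk := lt_trans lg gk.
have [Cn an _ nmin] := nxtP ag gk.
have nE : nxt alpha lambda = nxt alpha gamma.
  apply: nxt_eq => // [|y]; rewrite (co _ al); last by move=> [Cy _]; exact: nmin.
  have [x [Cx ax xl]] := ll _ a_l; split=> //; apply: le_lt_trans xl; apply: nmin => //; exact: ltW.
have tE xi : tail alpha lambda xi <-> tail alpha gamma xi.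
  split=> -[Cx xa h].
    split=> // [|_ mu am ma]; first by move: Cx; rewrite (co _ al) => -[].
    apply: h => //; first exact: coherent_acc al.
    by apply/(accC_initial _ co al); split=> //; exact: le_lt_trans a_l.
  split=> // [|_ mu /(accC_initial _ co al)[am _]]; last exact: h.
  by rewrite (co _ al); split=> //; exact: lt_trans a_l.
split=> [/(walk_inv ag)[Mg _ w h]|[Mg /(walk_inv a_l)[_ _ w h]]].
  split=> //; apply: walk_step => //.
  - by apply: le_trans Mg; exact: M_acc.
  - by move=> /(_ (coherent_acc co al)).
  - by rewrite nE.
  - by move=> xi /tE; exact: h.
apply: walk_step => //; first by rewrite -nE.
by move=> xi /tE; exact: h.
Qed.

(** As [C gamma] is closed, its limit points up to [beta] have a maximum. *)
Lemma last_acc beta gamma alpha lambda0 : beta < gamma -> gamma < kappa ->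
  accC C gamma lambda0 -> alpha < lambda0 -> lambda0 <= beta ->
  exists lambda, [/\ accC C gamma lambda, alpha < lambda, lambda <= beta &
    forall mu, accC C gamma mu -> mu <= beta -> mu <= lambda].
Proof.
move=> bg gk a0 al0 l0b.
pose S := [set lambda | accC C gamma lambda /\ lambda <= beta].
have Sb y : S y -> y <= beta by case.
have Sub y : S y -> y <= osup S := le_osup wfO Sb.
have S0 : S lambda0 by [].
exists (osup S); split.
- apply: contrapT => na.
  have lS : limit_of (C gamma) (osup S).
    split=> [|xi xs]; first by apply: lt_le_trans (Sub _ S0); case: a0 => _ [].
    apply: contrapT => none; have : osup S <= xi; last by rewrite leNgt xs.
    apply: osup_le => // y Sy; rewrite leNgt; apply/negP => xy; apply: none; exists y.
    split=> //; first by case: Sy => -[].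
    by rewrite lt_neqAle Sub // andbT; apply/eqP => E; apply: na; rewrite -E; case: Sy.
  apply: na; split=> //; apply: walk_closed => //.
  by apply: le_lt_trans bg; exact: osup_le.
- exact: lt_le_trans (Sub _ S0).
- exact: osup_le.
- by move=> mu am mb; exact: Sub.
Qed.

(** Both halves of subadditivity, by a common induction on the top point.  If
    [C gamma] has no point in [[alpha, beta)], then both walks make the same
    first step.  Otherwise the first step from [gamma] to [alpha] can be reached
    from [beta], being in [tail beta gamma], unless a limit point [lambda] of
    [C gamma] lies in between; then [lambda] takes over the role of that step
    by [walk_acc]. *)
Lemma walk_subadditive i gamma : gamma < kappa -> forall alpha beta,
  alpha <= beta -> beta <= gamma ->
  (walk i alpha beta -> walk i beta gamma -> walk i alpha gamma) /\
  (walk i alpha gamma -> walk i beta gamma -> walk i alpha beta).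
Proof.
elim/(ord_ind wfO): gamma => gamma IH gk alpha beta.
rewrite le_eqVlt => /orP[/eqP <-|ab]; first by split=> // _ _; exact: walk_refl.
rewrite le_eqVlt => /orP[/eqP->|bg]; first by split.
have ag := lt_trans ab bg; have bk := lt_trans bg gk.
have IHt := IH _ bg bk.
have [Cna ana nag na_min] := nxtP ag gk; have [Cnb bnb nbg nb_min] := nxtP bg gk.
have [bn|nab] := leP beta (nxt alpha gamma).
  have En : nxt beta gamma = nxt alpha gamma.
    by apply: nxt_eq => // y Cy bY; apply: na_min => //; exact: le_trans (ltW ab) bY.
  have [T1 T2] := IH _ nag (lt_trans nag gk) _ _ (ltW ab) bn.
  split=> [wab /(walk_inv bg)[Mg inc w h]|/(walk_inv ag)[Mg inc w h] /(walk_inv bg)[_ _ w' _]].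
    rewrite En in w; apply: walk_step => //; first exact: T1.
    move=> xi [Cx xa hx]; apply: (IHt _ _ (ltW xa) (ltW ab)).2 => //.
    apply: h; split=> //; first exact: lt_trans ab.
    move=> co mu am mb; apply: hx => //; rewrite leNgt; apply/negP => amu.
    have [Cm _] := am; have bm : beta <= mu by apply: le_trans bn _; apply: na_min => //; exact: ltW.
    have E : mu = beta by apply/eqP; rewrite eq_le mb.
    have [_ [_ lm]] := am; have [y [Cy ay ym]] := lm _ amu.
    by have := le_trans bn (na_min _ Cy (ltW ay)); rewrite -E leNgt ym.
  by rewrite En in w'; exact: T2.
have [T1 T2] := IHt _ _ ana (ltW nab).
have [[l0 [co al0 ltl l0b]]|none] := pselect (exists lambda0, [/\ coherent C gamma,
    accC C gamma lambda0, alpha < lambda0 & lambda0 <= beta]).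
  have [lambda [al a_l lb lmax]] := last_acc bg gk al0 ltl l0b.
  have [U1 U2] := IHt _ _ (ltW a_l) lb.
  have wl : walk i beta gamma -> walk i lambda beta.
    move=> /(walk_inv bg)[_ _ _ h]; move: lb; rewrite le_eqVlt => /orP[/eqP->|lb].
      exact: walk_refl.
    apply: h; split=> //; first by case: al.
  have sh := walk_acc i gk co al a_l.
  split=> [wab wbg|/sh[_ wal] wbg]; last by apply: U1 => //; exact: wl.
  apply/sh; split; first by have [] := walk_inv bg wbg.
  by apply: U2 => //; exact: wl.
have none' mu : coherent C gamma -> accC C gamma mu -> mu <= beta -> mu <= alpha.
  by move=> co am mb; rewrite leNgt; apply/negP => amu; apply: none; exists mu.
have tn : tail beta gamma (nxt alpha gamma).
  by split=> // co mu am mb; apply: le_trans ana; exact: none'.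
split=> [wab /(walk_inv bg)[Mg inc w h]|/(walk_inv ag)[Mg inc w h] /(walk_inv bg)[_ _ w' h']].
  apply: walk_step => //; first by apply: T2 => //; exact: h.
  move=> xi [Cx xa hx]; apply: (IHt _ _ (ltW xa) (ltW ab)).2 => //.
  apply: h; split=> //; first exact: lt_trans ab.
  by move=> co mu am mb; apply: hx => //; exact: none'.
by apply: T1 => //; exact: h'.
Qed.

Lemma walk_trans i alpha beta gamma : gamma < kappa -> alpha <= beta -> beta <= gamma ->
  walk i alpha beta -> walk i beta gamma -> walk i alpha gamma.
Proof. by move=> gk ab bg; have [] := walk_subadditive i gk ab bg. Qed.

Lemma walk_down i alpha beta gamma : gamma < kappa -> alpha <= beta -> beta <= gamma ->
  walk i alpha gamma -> walk i beta gamma -> walk i alpha beta.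
Proof. by move=> gk ab bg; have [] := walk_subadditive i gk ab bg. Qed.

(** Off the limit points of [C beta], the walks from [beta] to [alpha] and to
    [delta] agree in their first step and tail for all [alpha] close to [delta],
    and subadditivity transfers the remaining conditions from [alpha] to
    [delta]. *)
Lemma walk_limit i delta beta : beta < kappa -> delta <= beta ->
  limit_of [set alpha | walk i alpha beta] delta -> walk i delta beta.
Proof.
elim/(ord_ind wfO): beta => beta IH bk.
rewrite le_eqVlt => /orP[/eqP-> _|db lim]; first exact: walk_refl.
have [d0 lim'] := lim; have dk := lt_trans db bk.
have [a0 [w0 _ a0d]] := lim' _ d0.
have [Mb inc _ _] := walk_inv (lt_trans a0d db) w0.
have [ld|nld] := pselect (limit_of (C beta) delta).
  have Cd : C beta delta by exact: walk_closed.
  apply: walk_step => //.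
    by rewrite (@nxt_eq _ _ delta) //; exact: walk_refl.
  move=> xi [Cx xd h]; have [co|nco] := pselect (coherent C beta); last exact: inc.
  by have := h co delta (conj Cd ld) (lexx _); rewrite leNgt xd.
have [eta ed etaP] : exists2 eta, eta < delta & forall x, C beta x -> x < delta -> x <= eta.
  apply: contrapT => none; apply: nld; split=> // xi xd; apply: contrapT => none'.
  apply: none; exists xi => // x Cx xdel; rewrite leNgt; apply/negP => xix.
  by apply: none'; exists x.
have [Cn dn nb nmin] := nxtP db bk.
have near alpha : eta < alpha -> alpha < delta ->
    nxt alpha beta = nxt delta beta /\ forall xi, tail delta beta xi -> tail alpha beta xi.
  move=> ea ad; split.
    apply: nxt_eq => // [|y Cy ay]; first exact: le_trans (ltW ad) dn.
    apply: nmin => //; rewrite leNgt; apply/negP => yd.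
    by have := le_lt_trans (etaP _ Cy yd) ea; rewrite ltNge ay.
  move=> xi [Cx xd h]; split=> //; first exact: (le_lt_trans (etaP _ Cx xd)).
  by move=> co mu am ma; apply: h => //; exact: le_trans (ltW ad).
have far xi : xi < delta -> exists alpha, [/\ xi < alpha, eta < alpha, alpha < delta & walk i alpha beta].
  move=> xd; have md : Order.max xi eta < delta by rewrite gt_max xd.
  by have [alpha [w + ad]] := lim' _ md; rewrite gt_max => /andP[? ?]; exists alpha.
have wn : walk i delta (nxt delta beta).
  apply: IH => //; first exact: lt_trans bk.
  split=> // xi /far[alpha [xa ea ad w]]; exists alpha; split=> //=.
  by have [<- _] := near _ ea ad; have [] := walk_inv (lt_trans ad db) w.
apply: walk_step => // xi tx.
have [_ xd _] := tx.
have [alpha [xa ea ad w]] := far _ xd.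
have [nE tE] := near _ ea ad.
have [_ _ wan wt] := walk_inv (lt_trans ad db) w.
apply: (walk_trans dk (ltW xa) (ltW ad)); first by apply: wt; exact: tE.
apply: (walk_down (lt_trans nb bk) (ltW ad) dn) => //; by rewrite -nE.
Qed.

Lemma tail_small alpha beta : alpha < beta -> beta < kappa -> small theta (tail alpha beta).
Proof.
move=> ab bk; have [co|nco] := pselect (coherent C beta); last first.
  apply: small_le (walk_small Cw bk nco); apply: subset_card_le => x []//.
apply: small_finite => //; first by case: reg_theta.
apply: contrapT => inf.
have [|delta da [d0 ld]] := infinite_limit wfO inf (alpha := alpha); first by move=> x [].
have lC : limit_of (C beta) delta by split=> // x /ld[y [[Cy _ _] xy yd]]; exists y.
have aC : accC C beta delta by split=> //; apply: walk_closed => //; exact: le_lt_trans ab.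
have [y [[_ _ h] _ yd]] := ld _ d0.
by have := h co _ aC da; rewrite leNgt yd.
Qed.

Lemma walk_cover beta : beta < kappa -> forall alpha, alpha <= beta ->
  exists2 i, i < theta & walk i alpha beta.
Proof.
have t0 := regular_gt0 wfO reg_theta.
elim/(ord_ind wfO): beta => beta IH bk alpha.
rewrite le_eqVlt => /orP[/eqP->|ab]; first by exists \bot => //; exact: walk_refl.
have ak := lt_trans ab bk.
have bounded X gamma : gamma < beta -> small theta X -> X `<=` below gamma ->
    exists2 i, i < theta & forall xi, X xi -> walk i xi gamma.
  move=> gb sX Xg.
  have /choice[f fP] : forall xi, exists i, X xi -> i < theta /\ walk i xi gamma.
    move=> xi; have [Xx|?] := pselect (X xi); last by exists \bot.
    by have [i it w] := IH _ gb (lt_trans gb bk) _ (ltW (Xg _ Xx)); exists i.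
  have [|i it iP] := @regular_bound _ _ wfO _ reg_theta _ X f sX; first by move=> xi /fP[].
  exists i => // xi Xx; have [_] := fP _ Xx; apply: walk_mono; exact/ltW/iP.
have [Cn an nb _] := nxtP ab bk.
have [i1 i1t w1] := IH _ nb (lt_trans nb bk) _ an.
have [i2 i2t w2] : exists2 i, i < theta & forall xi, tail alpha beta xi -> walk i xi alpha.
  by apply: bounded => //; [exact: tail_small|move=> x []].
have [i3 i3t w3] : exists2 i, i < theta & ~ coherent C beta ->
    forall xi zeta, C beta xi -> C beta zeta -> xi < zeta -> walk i xi zeta.
  have [co|nco] := pselect (coherent C beta); first by exists \bot.
  have sC := walk_small Cw bk nco.
  have /choice[f fP] : forall zeta, exists i, C beta zeta -> i < theta /\
      forall xi, C beta xi -> xi < zeta -> walk i xi zeta.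
    move=> zeta; have [Cz|?] := pselect (C beta zeta); last by exists \bot.
    have [|||i it w] := bounded (C beta `&` below zeta) zeta.
    - exact: walk_below Cz.
    - by apply: small_le sC; apply: subset_card_le => x [].
    - by move=> x [].
    by exists i => _; split=> // xi Cx xz; exact: w.
  have [|i it iP] := @regular_bound _ _ wfO _ reg_theta _ (C beta) f sC; first by move=> zeta /fP[].
  exists i => // _ xi zeta Cx Cz xz; have [_ /(_ xi Cx xz)] := fP _ Cz.
  by apply: walk_mono; exact/ltW/iP.
exists (Order.max (M beta) (Order.max i1 (Order.max i2 i3))).
  by rewrite !gt_max M_theta // i1t i2t i3t.
apply: walk_step => //.
- by rewrite le_max lexx.
- move=> nco xi zeta Cx Cz xz; apply: walk_mono (w3 nco _ _ Cx Cz xz).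
  by rewrite !le_max lexx !orbT.
- by apply: walk_mono w1; rewrite !le_max lexx !orbT.
- by move=> xi tx; apply: walk_mono (w2 _ tx); rewrite !le_max lexx !orbT.
Qed.

Context (M_pos : forall i, i < theta -> positive kappa theta [set beta | i < M beta]).

(** Suppose that all pairs from [A] are at level [i], and let [M delta > i] for a
    limit point [delta] of [A].  By [walk_limit], [delta] is at level [i] under
    some member of [A]; hence so are the earlier points of [A] under [delta],
    which forces [M delta <= i]. *)
Lemma walks_strong : exists c, strong theta kappa c.
Proof.
apply: (@strong_of_relations _ _ wfO theta kappa walk).
- by move=> i j alpha beta _ _ ij _; exact: walk_mono.
- by move=> alpha beta ab bk; apply: walk_cover => //; exact: ltW.
- by move=> i alpha beta gamma _ ab bg gk; apply: walk_trans => //; exact: ltW.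
- by move=> i alpha beta gamma _ ab bg gk; apply: walk_down => //; exact: ltW.
- by move=> i delta beta _ db bk; apply: walk_limit => //; exact: ltW.
- move=> A i [Ak Au] it chain.
  have reg : Reg kappa theta by [].
  have /choice[g gP] : forall x, exists y, x < kappa -> A y /\ x < y.
    move=> x; have [xk|?] := pselect (x < kappa); last by exists \bot.
    by have [y Ay xy] := Au _ xk; exists y.
  have [xi /gP[/Ak//]|delta [dk cd cld Md]] := M_pos it (g := g).
  have limd := cf_mu_limit wfO reg cd; have [d0 _] := limd.
  have [beta Ab db] := Au _ dk; have bk := Ak _ Ab.
  have [Aa _] := gP _ (lt_trans d0 dk); have ad := cld _ d0.
  have wab x : A x -> x < delta -> walk i x beta.
    by move=> Ax xd; apply: chain => //; exact: lt_trans db.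
  have wdb : walk i delta beta.
    apply: walk_limit => //; first exact: ltW.
    split=> // xi xd; exists (g xi); have [Ag xg] := gP _ (lt_trans xd dk).
    by split=> //; [apply: wab => //; exact: cld|exact: cld].
  have : walk i (g \bot) delta by apply: (walk_down bk (ltW ad) (ltW db)) => //; exact: wab.
  by move=> /(walk_inv ad)[Mi _ _ _]; move: Md; rewrite /= ltNge Mi.
Qed.

End Walks.

(** * C-sequences without threads *)

Section Threads.
Context {d : Order.disp_t} {O : bOrderType d} (wfO : well_ordered O).
Implicit Types (A B D E X Y : set O).
Implicit Types (i j x y z mu nu sigma tau alpha beta gamma delta eps xi zeta lambda : O).
Context (theta kappa : O) (reg_theta : infinite_regular theta)
  (reg_kappa : infinite_regular kappa) (lt_theta_kappa : theta < kappa).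
Context (C : O -> set O) (Cw : walkable theta kappa C).

Let reg : Reg kappa theta. Proof. by []. Qed.

Lemma limit_walkable delta : delta < kappa -> limit delta -> limit_of (C delta) delta.
Proof.
move=> dk [d0 h]; split=> // xi /h[x [_ xix xd]].
have [y Cy xy] := walk_cofinal Cw xd dk; exists y; split=> //.
  exact: lt_le_trans xy.
exact: (walk_below Cw dk Cy).
Qed.

Lemma coherent_cf delta : delta < kappa -> cf delta = theta -> coherent C delta.
Proof.
move=> dk cd; apply: contrapT => /(walk_small Cw dk); rewrite -cd => sC.
have [e ed eP] := cf_bound wfO sC (f := id) (walk_below Cw dk).
have [x Cx ex] := walk_cofinal Cw ed dk.
by have := eP _ Cx; rewrite ltNge ex.
Qed.

Lemma positive_gt X xi : xi < kappa -> positive kappa theta X ->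
  positive kappa theta [set delta | [/\ X delta, delta < kappa, cf delta = theta & xi < delta]].
Proof.
move=> xk pX; have := positive_closed (g := fun=> xi) (fun _ _ => xk) pX.
apply: positive_sub => delta dk cd [Xd cl]; split=> //.
by apply: (cl \bot); case: (cf_mu_limit wfO reg cd).
Qed.

Lemma positive_ex X : positive kappa theta X ->
  exists delta, [/\ X delta, delta < kappa & cf delta = theta].
Proof.
by move=> pX; have [delta [_ dk cd Xd]] := positive_unbounded wfO reg pX lt_theta_kappa; exists delta.
Qed.

(** A coherent [C gamma] has fewer than [kappa] possible traces on [zeta], each
    determined by its last limit point and a finite set.  The induction replaces
    this count: at limit [zeta], either [C gamma `&` below zeta] is [C zeta], or
    it is bounded in [zeta] and the bound can be pressed down. *)
Lemma positive_constant zeta : zeta < kappa -> forall Y, positive kappa theta Y ->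
  exists x : set O, positive kappa theta [set gamma | Y gamma /\ C gamma `&` below zeta = x].
Proof.
elim/(ord_ind wfO): zeta => zeta IH zk Y pY.
have [limz|nlim] := pselect (limit zeta); last first.
  have [z0|zn0] := eqVneq zeta \bot.
    exists set0; apply: positive_sub pY => gamma _ _ Yg; split=> //.
    by apply/seteqP; split=> // x []; rewrite z0 /below /= ltx0.
  have [eta ez em] := not_limit_pred nlim (elimN eqP zn0).
  have [x px] := IH _ ez (lt_trans ez zk) _ pY.
  have : positive kappa theta ([set gamma | Y gamma /\ C gamma `&` below zeta = x `|` [set eta]]
      `|` [set gamma | Y gamma /\ C gamma `&` below zeta = x]).
    apply: positive_sub px => gamma _ _ [Yg <-].
    have lt y : y < zeta -> y <> eta -> y < eta.
      by move=> yz ye; rewrite lt_neqAle em // andbT; apply/eqP.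
    have [Ce|nCe] := pselect (C gamma eta); [left|right]; split=> //; apply/seteqP; split.
    - move=> y [Cy yz]; have [->|/eqP ye] := eqVneq y eta; [by right|left].
      by split=> //; exact: lt.
    - by move=> y [[Cy ye]|->]; split=> //; exact: lt_trans ez.
    - move=> y [Cy yz]; split=> //; apply: lt => // E; by rewrite E in Cy.
    - by move=> y [Cy ye]; split=> //; exact: lt_trans ez.
  by case/positive_or => p; [exists (x `|` [set eta])|exists x].
have : positive kappa theta (
    [set gamma | [/\ Y gamma, gamma < kappa, cf gamma = theta & zeta < gamma] /\ limit_of (C gamma) zeta] `|`
    [set gamma | [/\ Y gamma, gamma < kappa, cf gamma = theta & zeta < gamma] /\ ~ limit_of (C gamma) zeta]).
  apply: positive_sub (positive_gt zk pY) => gamma _ _ Yg.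
  by have [l|nl] := pselect (limit_of (C gamma) zeta); [left|right].
case/positive_or => p.
  exists (C zeta); apply: positive_sub p => gamma _ _ [[Yg gk cg zg] lz]; split=> //.
  apply/esym; apply: coherent_cf => //; split=> //; exact: walk_closed Cw _ _ gk zg lz.
set Y' := [set _ | _] in p.
have /choice[s sP] : forall gamma, exists s, Y' gamma ->
    s < zeta /\ forall x, C gamma x -> x < zeta -> x <= s.
  move=> gamma; have [[Yg nl]|?] := pselect (Y' gamma); last by exists \bot.
  apply: contrapT => none; apply: nl; have [z0 _] := limz; split=> // xi xz.
  apply: contrapT => none'; apply: none; exists xi => _; split=> // x Cx xz'.
  by rewrite leNgt; apply/negP => xx; apply: none'; exists x.
have [|s0 s0k ps0] := fodor wfO reg_kappa (f := s) p.
  move=> gamma _ _ Yg; have [sz _] := sP _ Yg.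
  by have [[_ _ _ zg] _] := Yg; exact: lt_trans zg.
have [g0 [[Yg0 Es] _ _]] := positive_ex ps0.
have s0z : s0 < zeta by rewrite -Es; have [] := sP _ Yg0.
have sz := limit_succ wfO limz s0z.
have [x px] := IH _ sz (lt_trans sz zk) _ ps0.
exists x; apply: positive_sub px => gamma _ _ [[Yg Esg] <-].
have [_ sg] := sP _ Yg; have [[YY _ _ _] _] := Yg; split=> //.
apply/seteqP; split=> y [Cy yz]; split=> //; last exact: lt_trans sz.
by apply: (@le_lt_trans _ _ s0); [rewrite -Esg; exact: sg|exact: lt_succ s0z].
Qed.

Definition traces eps : set (set O) :=
  [set x | positive kappa theta [set gamma | C gamma `&` below eps = x]].

(** An injection [e] of [theta] into the traces turns the trace of [C delta] at
    [eps] into a weight, and coherence keeps the trace, hence the weight, the same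
    along limit points of [C delta]. *)
Lemma many_traces_strong eps : eps < kappa -> below theta #<= traces eps ->
  exists c, strong theta kappa c.
Proof.
move=> ek /(card_le_fun set0)[e [eT einj]].
have t0 := regular_gt0 wfO reg_theta.
have /choice[h hP] : forall x : set O, exists i, i < theta /\ forall j, j < theta -> e j = x -> i = j.
  move=> x; have [[j [jt ej]]|none] := pselect (exists j, j < theta /\ e j = x).
    by exists j; split=> // j' jt' ej'; apply: einj => //; rewrite ej.
  by exists \bot; split=> // j jt ej; case: none; exists j.
pose M delta := if `[< coherent C delta /\ eps < delta >] then h (C delta `&` below eps) else \bot.
apply: (walks_strong wfO reg_theta lt_theta_kappa Cw (M := M)).
- by move=> beta _; rewrite /M; case: asboolP => // _; have [] := hP (C beta `&` below eps).
- move=> gamma lambda gk co al; rewrite {1}/M; case: asboolP => [[_ el]|_] /=; last exact: le0x.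
  have lg : lambda < gamma by case: al => /(walk_below Cw gk).
  rewrite /M; case: asboolP => [_|[]] /=; last by split=> //; exact: lt_trans lg.
  suff -> : C lambda `&` below eps = C gamma `&` below eps by [].
  rewrite (co _ al) -setIA; congr (C gamma `&` _).
  by apply/seteqP; split=> [x []//|x xe]; split=> //; exact: lt_trans el.
- move=> i it; have st := regular_succ wfO reg_theta it.
  apply: positive_sub (positive_gt ek (eT _ st)) => delta dk cd [/= E _ _ ed].
  rewrite /M; case: asboolP => [_|[]] /=; last by split=> //; exact: coherent_cf.
  by have [_ hE] := hP (C delta `&` below eps); rewrite (hE _ st) ?E //; exact: lt_succ it.
Qed.

(** A narrow tree has a cofinal branch.  On a positive set [R] of [delta], the
    traces at [delta] are told apart by their restrictions to a fixed [eps], and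
    all the [C delta] have the same trace there; so any two of them agree below
    smaller members of [R], and their union is a thread. *)
Lemma few_traces_thread : (forall eps, eps < kappa -> small theta (traces eps)) ->
  exists2 D, club D kappa &
    forall alpha, D alpha -> limit_of D alpha -> D `&` below alpha = C alpha.
Proof.
move=> few.
pose R0 := [set delta | forall eps, eps < delta -> traces eps (C delta `&` below eps)].
have pR0 : positive kappa theta R0.
  have : positive kappa theta (R0 `|` ~` R0).
    by apply: positive_sub (positive_full wfO reg_kappa reg) => delta _ _ _; rewrite setUv.
  case/positive_or => // p; exfalso.
  have /choice[f fP] : forall delta, exists eps, (~` R0) delta ->
      eps < delta /\ ~ traces eps (C delta `&` below eps).
    move=> delta; have [nR|?] := pselect ((~` R0) delta); last by exists \bot.
    apply: contrapT => none; apply: nR => eps ed; apply: contrapT => nT.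
    by apply: none; exists eps.
  have [|eps ek pe] := fodor wfO reg_kappa (f := f) p; first by move=> delta _ _ /fP[].
  have [x px] := positive_constant ek pe.
  have [delta [[[nR fd] E] _ _]] := positive_ex px.
  have [_] := fP _ nR; rewrite fd E; apply.
  by apply: positive_sub px => gamma _ _ [].
have /choice[f fP] : forall delta, exists eps, delta < kappa -> cf delta = theta ->
    eps < delta /\ forall x y : set O, traces delta x -> traces delta y ->
      (forall z, z < eps -> x z <-> y z) -> x = y.
  move=> delta; have [dk|?] := pselect (delta < kappa); last by exists \bot.
  have [cd|?] := pselect (cf delta = theta); last by exists \bot.
  have d0 : \bot < delta by case: (cf_mu_limit wfO reg cd).
  have sub A : traces delta A -> A `<=` below delta.
    by move=> /positive_ex[gamma [<- _ _]] z [].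
  have sT : small (cf delta) (traces delta) by rewrite cd; exact: few.
  have /choice[r rP] : forall xy : set O * set O, exists z, z < delta /\
      (traces delta xy.1 -> traces delta xy.2 -> xy.1 <> xy.2 -> ~ (xy.1 z <-> xy.2 z)).
    move=> [x y] /=; have [[z [zd nz]]|none] := pselect (exists z, z < delta /\ ~ (x z <-> y z)).
      by exists z.
    exists \bot; split=> // Tx Ty; case; apply/funext => z; apply/propext.
    apply: contrapT => nz; have [zd|nzd] := pselect (z < delta).
      by apply: none; exists z.
    by apply: nz; split=> [/(sub _ Tx)|/(sub _ Ty)].
  have /choice[r' r'P] : forall x : set O, exists e, e < delta /\
      forall y : set O, traces delta y -> r (x, y) < e.
    move=> x; have [|e ed eP] := cf_bound wfO sT (f := fun y : set O => r (x, y)); last by exists e.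
    by move=> y _; have [] := rP (x, y).
  have [|e ed eP] := cf_bound wfO sT (f := r'); first by move=> x _; have [] := r'P x.
  exists e => _ _; split=> // x y Tx Ty agree; apply: contrapT => ne.
  have [_ /(_ Tx Ty ne)] := rP (x, y); apply; apply: agree.
  by have [_ h] := r'P x; exact: lt_trans (h _ Ty) (eP _ Tx).
have [|eps ek pe] := fodor wfO reg_kappa (f := f) pR0; first by move=> delta dk cd _; have [] := fP _ dk cd.
have [x0 px0] := positive_constant ek pe.
(* for [delta < beta] in [R], the trace of [C beta] at [delta] is determined by [x0] *)
pose R := [set delta | [/\ R0 delta, f delta = eps, C delta `&` below eps = x0, delta < kappa & cf delta = theta]].
have pR : positive kappa theta R by apply: positive_sub px0 => delta dk cd [[? ?] ?].
have Reps delta : R delta -> eps < delta.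
  by move=> [_ <- _ dk cd]; have [] := fP _ dk cd.
have Rk delta : R delta -> delta < kappa by case.
have key delta beta gamma : R delta -> R beta -> R gamma -> delta < beta -> delta < gamma ->
    C beta `&` below delta = C gamma `&` below delta.
  move=> Rd Rb Rg db dg; have [_ fd _ dk cd] := Rd; have [_ sep] := fP _ dk cd.
  have ed := Reps _ Rd.
  have agree gamma' z : R gamma' -> z < eps -> (C gamma' `&` below delta) z <-> x0 z.
    move=> [_ _ <- _ _] ze; split=> -[Cz zd]; split=> //.
    exact: lt_trans ed.
  apply: sep.
  - by have [h _ _ _ _] := Rb; exact: h.
  - by have [h _ _ _ _] := Rg; exact: h.
  - by move=> z; rewrite fd => ze; rewrite agree // agree.
pose X := [set xi | exists delta beta, [/\ R delta, R beta, delta < beta, xi < delta & C beta xi]].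
have XE delta beta : R delta -> R beta -> delta < beta -> X `&` below delta = C beta `&` below delta.
  move=> Rd Rb db; apply/seteqP; split=> [z [[delta' [beta' [Rd' Rb' db' zd' Cz]]] zd]|z [Cz zd]]; last first.
    by split=> //; exists delta, beta.
  have [dd|dd] := leP delta delta'.
    have : (C beta' `&` below delta) z by [].
    by rewrite (key _ beta' beta) //; exact: le_lt_trans db'.
  have : (C beta' `&` below delta') z by [].
  by rewrite (key _ beta' beta) //; [case|exact: lt_trans db].
have /choice[g gP] : forall x, exists y, x < kappa -> R y /\ x < y.
  move=> x; have [xk|?] := pselect (x < kappa); last by exists \bot.
  by have [y [xy _ _ Ry]] := positive_unbounded wfO reg pR xk; exists y.
have two xi : xi < kappa -> exists delta beta, [/\ R delta, R beta, xi < delta & delta < beta].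
  move=> xk; have [R1 x1] := gP _ xk; have [R2 x2] := gP _ (Rk _ R1).
  by exists (g xi), (g (g xi)).
have gk xi : xi < kappa -> g xi < kappa by move=> /gP[/Rk].
have X_lim alpha delta beta : R delta -> R beta -> delta < beta -> alpha <= delta ->
    limit_of X alpha <-> limit_of (C beta) alpha.
  move=> Rd Rb db ad.
  by rewrite -(limit_of_initial X ad) (XE _ _ Rd Rb db) limit_of_initial.
exists X.
  apply/(clubP wfO _ (regular_gt0 wfO reg_kappa)); split.
  - by move=> x [delta [beta [Rd _ _ xd _]]]; exact: lt_trans (Rk _ Rd).
  - move=> zeta zk lz; have [delta [beta [Rd Rb zd db]]] := two _ zk.
    exists delta, beta; split=> //; apply: (walk_closed Cw); [exact: Rk|exact: lt_trans db|].
    by apply/(X_lim _ delta beta) => //; exact: ltW.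
  - split=> [|xi xk]; first exact: regular_gt0 reg_kappa.
    have [beta [xb bk cb [Rb cl]]] := positive_unbounded wfO reg (positive_closed gk pR) xk.
    have [_ /(_ _ xb)[x [Cx xix xb']]] := limit_walkable bk (cf_mu_limit wfO reg cb).
    have xk' := lt_trans xb' bk; have [Rg xg] := gP _ xk'.
    by exists x; split=> //; exists (g x), beta; split=> //; exact: cl.
move=> alpha Xa la.
have ak : alpha < kappa by have [delta [_ [Rd _ _ ad _]]] := Xa; exact: lt_trans (Rk _ Rd).
have [delta [beta [Rd Rb ad db]]] := two _ ak.
have aC : accC C beta alpha.
  split; last by apply/(X_lim _ delta beta) => //; exact: ltW.
  by have : (X `&` below delta) alpha by []; rewrite (XE _ _ Rd Rb db) => -[].
have [_ _ _ bk cb] := Rb.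
rewrite (coherent_cf bk cb aC).
have sub Z : Z `&` below alpha = (Z `&` below delta) `&` below alpha.
  rewrite -setIA; congr (Z `&` _); apply/seteqP; split=> [x xa|x []//]; split=> //.
  exact: lt_trans ad.
by rewrite (sub X) (sub (C beta)) (XE _ _ Rd Rb db).
Qed.

Theorem unthreaded_strong :
  (forall D, club D kappa -> exists alpha, [/\ D alpha, limit_of D alpha & D `&` below alpha <> C alpha]) ->
  exists c, strong theta kappa c.
Proof.
move=> nothread; apply: contrapT => none.
have [eps ek|D Dc thr] := few_traces_thread.
  by apply: contrapT => /(not_small wfO)/(many_traces_strong ek).
by have [alpha [Da la]] := nothread _ Dc; apply; exact: thr.
Qed.

End Threads.

(** * From square sequences to strong colorings *)

Section Square.
Context {d : Order.disp_t} {O : bOrderType d} (wfO : well_ordered O).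
Implicit Types (A B D E X Y : set O).
Implicit Types (i j x y z mu nu sigma tau alpha beta gamma delta eps xi zeta lambda : O).
Context (theta kappa : O) (reg_theta : infinite_regular theta)
  (reg_kappa : infinite_regular kappa) (lt_theta_kappa : theta < kappa).

(** At successors, [C beta] is replaced by the singleton of the predecessor, which
    makes each [C beta] cofinal in [beta]; a C-sequence may have [C 1] empty. *)
Definition at_limits (C : O -> set O) beta : set O :=
  if `[< limit beta >] then C beta else [set x | x < beta /\ forall y, y < beta -> y <= x].

Lemma at_limitsE C beta : limit beta -> at_limits C beta = C beta.
Proof. by rewrite /at_limits; case: asboolP. Qed.

Lemma at_limits_walkable C : (forall beta, beta < kappa -> limit beta ->
    [/\ C beta `<=` below beta, limit_of (C beta) beta,
        forall gamma, gamma < beta -> limit_of (C beta) gamma -> C beta gamma &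
        coherent C beta \/ small theta (C beta)]) ->
  walkable theta kappa (at_limits C).
Proof.
move=> H; split=> beta.
- move=> bk; rewrite /at_limits; case: asboolP => [lb|nlb x []//].
  by have [] := H _ bk lb.
- move=> beta' ab bk; rewrite /at_limits; case: asboolP => [lb|nlb].
    have [_ [_ h] _ _] := H _ bk lb; have [x [Cx ax _]] := h _ ab.
    by exists x => //; exact: ltW.
  have [b0|b0] := eqVneq beta' \bot; first by move: ab; rewrite b0 ltx0.
  have [eta eb em] := not_limit_pred nlb (elimN eqP b0).
  by exists eta => //; exact: em.
- move=> gamma bk gb; rewrite /at_limits; case: asboolP => [lb|nlb].
    by have [_ _ h _] := H _ bk lb; exact: h.
  move=> [g0 h]; have [x [[xb xm] _ xg]] := h _ g0.
  have [y [[yb _] xy _]] := h _ xg.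
  by have := xm _ yb; rewrite leNgt xy.
- move=> bk nco; have lb : limit beta.
    apply: contrapT => nlb; apply: nco => lambda [_ [l0 ll]].
    move: ll; rewrite /at_limits; case: asboolP => // _ h.
    have [x [[xb xm] _ xl]] := h _ l0; have [y [[yb _] xy _]] := h _ xl.
    by have := xm _ yb; rewrite leNgt xy.
  have [_ _ _ [co|]] := H _ bk lb; last by rewrite at_limitsE.
  case: nco => lambda; rewrite /accC (at_limitsE C lb) => -[Cl ll].
  by rewrite (at_limitsE C (limit_of_limit ll)); exact: co.
Qed.

Lemma square_strong : square kappa theta -> exists c, strong theta kappa c.
Proof.
move=> [C [Cseq coh guess]].
apply: (unthreaded_strong wfO reg_theta reg_kappa lt_theta_kappa (C := at_limits C)); last first.
  move=> D Dc; have [alpha aD ne] := guess _ Dc.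
  have [[Dk _] _] := Dc.
  have [Da la] := (accP wfO _ Dk).1 aD.
  by exists alpha; rewrite at_limitsE //; exact: limit_of_limit la.
apply: at_limits_walkable => beta bk lb.
have [/(closed_inP wfO)[Cb Ccl] supC] := Cseq _ bk.
have supb : osup (below beta) = beta.
  have /(limit_of_osup wfO)[] : limit_of (below beta) beta.
    by apply: limit_of_sub lb.
  by rewrite setIid.
have limC : limit_of (C beta) beta.
  by apply/(limit_of_osup wfO); rewrite setIidl // supC supb; split=> //; case: lb.
split=> //.
have [co|nco] := pselect (coherent C beta); [by left|right].
have [[lambda [al ne]]|none] := pselect (exists lambda, accC C beta lambda /\
    C lambda <> C beta `&` below lambda); last first.
  by case: nco => lambda al; apply: contrapT => ne; apply: none; exists lambda.
have [Cl ll] := al; have lb' : lambda < beta := Cb _ Cl; have lk := lt_trans lb' bk.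
have [[bd E]|[ot _]] := coh _ _ bk ((is_limitP wfO _).2 lb) ((accP wfO _ Cb).2 al).
  have [/(closed_inP wfO)[Clb _] supl] := Cseq _ lk.
  have [l0 llim] := limit_of_limit ll.
  have lsup : osup (below lambda) = lambda.
    have /(limit_of_osup wfO)[] : limit_of (below lambda) lambda.
      by apply: (@limit_of_sub _ _ setT) => //; split.
    by rewrite setIid.
  have [_ limCl] : limit_of (C lambda) lambda.
    by apply/(limit_of_osup wfO); rewrite setIidl // supl lsup.
  case: ne; rewrite {1}E; congr (C beta `&` below _).
  case: (ltgtP bd lambda) => // [bl|lb''].
    have [x [Cx bx _]] := limCl _ bl.
    by move: Cx; rewrite E => -[_]; rewrite /below /= ltNge ltW.
  have : C lambda lambda by rewrite E.
  by move=> /Clb; rewrite /below /= ltxx.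
have [tau tb texP] := otp_ex wfO Cb.
have : exists f : O -> O, set_bij (below (otp (C beta))) (C beta) f /\
    forall x y, x < y -> y < otp (C beta) -> f x < f y.
  by apply: (@xgetPex _ \bot [set tau | exists f : O -> O, set_bij (below tau) (C beta) f /\
    forall x y, x < y -> y < tau -> f x < f y]); exists tau.
move=> [f [[ff finj fsurj] _]]; exists (otp (C beta)) => //.
have /card_eqPle[] : below (otp (C beta)) #= C beta => //.
apply: (@fun_card_eq _ _ _ _ f) => [x /ff//|x y bx by_|y /fsurj[x bx <-]]; last by exists x.
by apply: finj; exact: mem_set.
Qed.

End Square.

(** * The case of a single regular cardinal below [kappa] *)

Section Single.
Context {d : Order.disp_t} {O : bOrderType d} (wfO : well_ordered O).
Implicit Types (A B D X Y : set O).
Implicit Types (i j x y z mu nu sigma tau alpha beta gamma delta eps xi zeta lambda : O).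
Context (theta kappa : O) (reg_theta : infinite_regular theta)
  (reg_kappa : infinite_regular kappa) (lt_theta_kappa : theta < kappa).
Context (single : forall mu, Reg kappa mu -> mu = theta).

Let reg : Reg kappa theta. Proof. by []. Qed.

Lemma single_cf alpha : alpha < kappa -> limit alpha -> cf alpha = theta.
Proof.
move=> ak la; apply: single; split; last exact: cf_regular.
by apply: le_lt_trans ak; exact: cf_le.
Qed.

(** The first infinite ordinal is regular, so it is [theta]. *)
Lemma single_finite tau : tau < theta -> finite_set (below tau).
Proof.
move=> tt; apply: contrapT => inf.
have [w winf wmin] := @least_ex _ _ wfO [set t | infinite_set (below t)] tau inf.
have wlim : limit w.
  apply: contrapT => /not_limit_pred h.
  have [|eta ew em] := h.
    move=> w0; apply: winf; rewrite w0 (_ : below \bot = set0); first exact: finite_set0.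
    by apply/seteqP; split=> // x; rewrite /below /= ltx0.
  have fin : finite_set (below eta).
    by apply: contrapT => inf'; have := wmin _ inf'; rewrite leNgt ew.
  apply: winf; apply: (@sub_finite_set _ _ (below eta `|` [set eta])).
    by move=> x /em; rewrite le_eqVlt => /orP[/eqP|]; [right|left].
  by rewrite finite_setU.
have wt : w < theta by apply: le_lt_trans tt; exact: wmin.
have cfw := single_cf (lt_trans wt lt_theta_kappa) wlim.
by have := cf_le wfO w; rewrite cfw leNgt wt.
Qed.

(** Number a cofinal subset of [delta] by [theta] and keep the points that exceed
    all those with smaller numbers: below any bound only finitely many remain. *)
Lemma ladder_ex delta : delta < kappa -> limit delta -> exists L : set O,
  [/\ L `<=` below delta, limit_of L delta & forall gamma, gamma < delta -> ~ limit_of L gamma].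
Proof.
move=> dk ld; have [a [ad acof]] := cf_cofinal wfO delta.
rewrite (single_cf dk ld) => /card_eqPle[ale _].
have [nu [nuP nuinj]] := card_le_fun \bot ale.
pose L := [set x | a x /\ forall y, a y -> nu y < nu x -> y < x].
exists L; split; first by move=> x [/ad].
  split=> [|xi xd]; first by case: ld.
  have [y ay sy] := acof _ (limit_succ wfO ld xd).
  pose S := [set i | exists x, [/\ a x, xi < x & nu x = i]].
  have Sy : S (nu y) by exists y; split=> //; exact: lt_le_trans (lt_succ wfO xd) sy.
  have [x [ax xix nux]] := omin_mem wfO Sy.
  exists x; split=> //; last exact: ad.
  split=> // z az; rewrite nux => lt; apply: le_lt_trans xix.
  rewrite leNgt; apply/negP => xz.
  by have : omin S <= nu z; [apply: omin_le => //; exists z|rewrite leNgt lt].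
move=> gamma gd lg; apply: (limit_of_infinite wfO lg).
have [z az gz] := acof _ gd.
have fz := single_finite (nuP _ az).
have le : L `&` below gamma #<= below (nu z).
  apply: (@fun_card_le _ _ _ _ nu) => [x [[ax rx] xg]|x y [[ax _] _] [[ay _] _]]; last exact: nuinj.
  rewrite /below /= ltNge le_eqVlt; apply/negP => /orP[/eqP E|lt].
    by move: xg; rewrite /below /= -(nuinj _ _ az ax E) ltNge gz.
  by have := lt_trans (rx _ az lt) xg; rewrite ltNge gz.
exact: card_le_finite le fz.
Qed.

Lemma single_strong : exists c, strong theta kappa c.
Proof.
have /choice[L LP] : forall delta, exists L : set O, delta < kappa -> limit delta ->
    [/\ L `<=` below delta, limit_of L delta & forall gamma, gamma < delta -> ~ limit_of L gamma].
  move=> delta; have [dk|?] := pselect (delta < kappa); last by exists set0.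
  have [ld|?] := pselect (limit delta); last by exists set0.
  by have [L LP] := ladder_ex dk ld; exists L.
apply: (unthreaded_strong wfO reg_theta reg_kappa lt_theta_kappa (C := at_limits L)); last first.
  move=> D Dc; have [Dk Dcl [_ Dl]] := (clubP wfO D (regular_gt0 wfO reg_kappa)).1 Dc.
  have lims xi : xi < kappa -> exists delta, [/\ limit_of D delta, xi < delta & delta < kappa].
    move=> xk; have [x|x|delta [? ? ? ? ?]] := common_limits wfO reg_kappa reg (A := D) (B := D) _ _ xk.
    - by move=> /Dl.
    - by move=> /Dl.
    by exists delta.
  have [delta [_ dk _ ll _]] := common_limits wfO reg_kappa reg lims lims lt_theta_kappa.
  have lD := limit_of_limit_of ll; have ld := limit_of_limit lD.
  exists delta; split=> //; first exact: Dcl.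
  rewrite at_limitsE // => E; have [_ _ nolim] := LP _ dk ld.
  have [d0 h] := ll; have [x [lx _ xd]] := h _ d0.
  apply: (nolim _ xd); rewrite -E limit_of_initial //; exact: ltW.
apply: at_limits_walkable => beta bk lb; have [Lb lL nolim] := LP _ bk lb.
split=> //; first by move=> gamma gb /(nolim _ gb).
left=> lambda [Ll ll]; case: (nolim _ (Lb _ Ll) ll).
Qed.

(** Let the sets [Dle c i alpha] be finite on a club [E].  Those of their
    members that are limits of [E] become the limit points of the matrix: below
    each member [x], and below [alpha] itself, a ladder for [x] is inserted.  The ladder consists of successors of records of
    [x], the points of [E] with a color [c beta x] smaller than that of all later
    ones.  When [i] grows and new points appear below [x], a record of [x] just
    below a new point is a record of the new point as well, so the sets grow with
    [i] ([rung_mono]). *)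
Section Records.
Context (c : O -> O -> O) (col : coloring kappa theta c) (sub : subadditive kappa c).
Context (E : set O) (E_closed : forall delta, delta < kappa -> limit_of E delta -> E delta)
  (E_below : E `<=` below kappa) (E_unb : forall x, x < kappa -> exists y, [/\ E y, x < y & y < kappa])
  (E_finite : forall i alpha, i < theta -> E alpha -> finite_set (Dle c i alpha `&` E)).

Definition mark i alpha : set O := Dle c i alpha `&` E.

(** The member of [mark i alpha], or else [alpha] itself, whose ladder is in
    charge at [beta]. *)
Definition above i alpha beta : O := omin [set x | (mark i alpha x \/ x = alpha) /\ beta < x].

Definition is_record alpha beta : Prop :=
  [/\ E beta, beta < alpha & forall x, E x -> beta < x -> x < alpha -> c beta alpha < c x alpha].

Definition rung i alpha : set O :=
  mark i alpha `|` [set z | exists beta, [/\ beta < alpha, is_record (above i alpha beta) beta & z = succ beta]].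

Lemma aboveP i alpha beta : beta < alpha ->
  [/\ mark i alpha (above i alpha beta) \/ above i alpha beta = alpha, beta < above i alpha beta,
    above i alpha beta <= alpha &
    forall x, mark i alpha x \/ x = alpha -> beta < x -> above i alpha beta <= x].
Proof.
move=> ba.
have [mA bA] : [set x | (mark i alpha x \/ x = alpha) /\ beta < x] (above i alpha beta).
  by apply: (omin_mem wfO (x := alpha)); split=> //; right.
by split=> // [|x mx bx]; apply: omin_le => //; split=> //; right.
Qed.

Lemma record_cofinal delta : delta < kappa -> limit_of E delta -> forall xi, xi < delta ->
  exists2 beta, is_record delta beta & xi <= beta.
Proof.
move=> dk ld xi xd; have [_ /(_ _ xd)[x [Ex xix xd']]] := ld.
have jt := col xd' dk.
have [m [[md cm] Em] mP] := finite_max (E_finite jt (E_closed dk ld)) (conj (conj xd' (lexx _)) Ex).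
exists m.
  split=> // y Ey my yd; rewrite ltNge; apply/negP => cy.
  have /mP : (Dle c (c x delta) delta `&` E) y by split=> //; split=> //; exact: le_trans cm.
  by rewrite leNgt my.
by apply: le_trans (mP x _) => //; exact: ltW.
Qed.

(** Records below [delta] have colors below [c delta alpha], and there are
    finitely many such points. *)
Lemma record_discrete alpha delta : E alpha -> E delta -> delta < alpha ->
  ~ limit_of (is_record alpha) delta.
Proof.
move=> Ea Ed da lim; apply: (limit_of_infinite wfO lim).
apply: sub_finite_set (E_finite (col da (E_below Ea)) Ea).
by move=> x [[Ex xa xr] xd]; split=> //; split=> //; apply/ltW/xr.
Qed.

Lemma rung_below i alpha : limit alpha -> rung i alpha `<=` below alpha.
Proof.
move=> la x [[[]]//|[beta [ba _ ->]]]; exact: limit_succ.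
Qed.

Lemma rung_limit i alpha delta : i < theta -> alpha < kappa -> limit_of E alpha -> delta <= alpha ->
  limit_of (rung i alpha) delta <-> limit_of E delta /\ (mark i alpha delta \/ delta = alpha).
Proof.
move=> it ak la da; have Ea := E_closed ak la; have dk := le_lt_trans da ak.
have bnd : limit delta -> exists2 e, e < delta & forall x, mark i alpha x -> x < delta -> x < e.
  move=> limd; have [||e ed eP] := @finite_bound _ _ wfO (mark i alpha `&` below delta) delta limd.
  - by apply: sub_finite_set (E_finite it Ea) => x [].
  - by move=> x [].
  by exists e => // x mx xd; apply: eP.
split=> [lr|[ld md]].
  have limd := limit_of_limit lr; have [e ed eP] := bnd limd; have [d0 hr] := lr.
  pose S := [set x | (mark i alpha x \/ x = alpha) /\ delta <= x].
  have Sa : S alpha by split=> //; right.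
  have [mA dA] : S (omin S) by exact: omin_mem Sa.
  have abE beta : e <= beta -> beta < delta -> above i alpha beta = omin S.
    move=> eb bd; apply: omin_eq.
      by split=> //; exact: lt_le_trans dA.
    move=> y [my by_]; apply: omin_le => //; split=> //; rewrite leNgt; apply/negP => yd.
    case: my => [my|ya]; last by move: yd; rewrite ya ltNge da.
    by have := lt_le_trans (eP _ my yd) eb; rewrite ltNge ltW.
  have lrec : limit_of (is_record (omin S)) delta.
    split=> // xi xd.
    have md : Order.max (succ xi) (succ e) < delta by rewrite gt_max !limit_succ.
    have [x [rx + xd']] := hr _ md; rewrite gt_max => /andP[sx ex].
    case: rx => [mx|[beta [ba rb xE]]].
      have := eP _ mx xd'; rewrite ltNge ltW //.
      exact: lt_trans (lt_succ wfO ed) ex.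
    have bd : beta < delta by apply: lt_trans xd'; rewrite xE; exact: lt_succ ba.
    have eb : e < beta by apply: lt_le_trans (lt_succ wfO ed) _; apply: lt_succ_le => //; rewrite -xE.
    exists beta; split=> //; first by rewrite -(abE beta) //; exact: ltW.
    by apply: lt_le_trans (lt_succ wfO xd) _; apply: lt_succ_le => //; rewrite -xE.
  have ld : limit_of E delta by apply: limit_of_sub lrec => x _ [].
  have Ed := E_closed dk ld.
  have EA : E (omin S) by case: mA => [[]//|->].
  split=> //; suff -> : delta = omin S by [].
  apply/eqP; rewrite eq_le dA leNgt; apply/negP => dA'.
  exact: record_discrete lrec.
have limd := limit_of_limit ld; have [e ed eP] := bnd limd.
split=> [|xi xd]; first by case: ld.
have m_d : Order.max xi e < delta by rewrite gt_max xd.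
have [beta rb] := record_cofinal dk ld m_d; rewrite ge_max => /andP[xb eb].
have [Eb bd _] := rb; have ba := lt_le_trans bd da.
exists (succ beta); split; [right|exact: le_lt_trans xb (lt_succ wfO bd)|exact: limit_succ].
exists beta; split=> //; suff -> : above i alpha beta = delta by [].
apply: omin_eq => // y [my by_]; rewrite leNgt; apply/negP => yd.
case: my => [my|ya]; last by move: yd; rewrite ya ltNge da.
by have := lt_le_trans (eP _ my yd) eb; rewrite ltNge ltW.
Qed.

Lemma mark_initial i alpha lambda : alpha < kappa -> mark i alpha lambda ->
  mark i lambda = mark i alpha `&` below lambda.
Proof.
move=> ak [[la cl] El]; apply/seteqP; split=> [x [[xl cx] Ex]|x [[[xa cx] Ex] xl]].
  split=> //; split=> //; split; first exact: lt_trans la.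
  exact: (subadditive_trans sub xl la ak).
split=> //; split=> //; exact: (subadditive_down sub xl la ak).
Qed.

Lemma rung_initial i alpha lambda : alpha < kappa -> limit lambda ->
  mark i alpha lambda -> rung i lambda = rung i alpha `&` below lambda.
Proof.
move=> ak ll ml; have [[la cl] El] := ml.
have mE := mark_initial ak ml.
have abE beta : beta < lambda -> above i lambda beta = above i alpha beta.
  move=> bl; have [mA bA Aa Amin] := aboveP i (lt_trans bl la).
  have Al : above i alpha beta <= lambda by apply: Amin => //; left.
  apply: omin_eq => [|y [my by_]].
    split=> //; move: Al; rewrite le_eqVlt => /orP[/eqP|Al]; [by right|left].
    rewrite mE; split=> //; case: mA => // E'; by move: Al; rewrite E' ltNge ltW.
  by apply: Amin => //; left; case: my => [|->//]; rewrite mE => -[].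
apply/seteqP; split=> [z|z [rz zl]].
  move=> [|[beta [bl rb ->]]]; first by rewrite mE => -[mz zl]; split=> //; left.
  split; last exact: limit_succ.
  by right; exists beta; split=> //; [exact: lt_trans la|rewrite -abE].
case: rz => [mz|[beta [ba rb zE]]]; first by left; rewrite mE.
have bl : beta < lambda by apply: lt_trans zl; rewrite zE; exact: lt_succ ba.
by right; exists beta; split=> //; rewrite abE.
Qed.

Lemma rung_mono i j alpha : i <= j -> alpha < kappa -> E alpha -> rung i alpha `<=` rung j alpha.
Proof.
move=> ij ak Ea z.
have mij x : mark i alpha x -> mark j alpha x.
  by move=> [[xa cx] Ex]; split=> //; split=> //; exact: le_trans ij.
move=> [mz|[beta [ba rb ->]]]; [by left; exact: mij|right; exists beta; split=> //].
have [mi bi ia imin] := aboveP i ba; have [mj bj ja jmin] := aboveP j ba.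
have ji : above j alpha beta <= above i alpha beta.
  by apply: jmin => //; case: mi => [/mij|]; [left|right].
move: ji; rewrite le_eqVlt => /orP[/eqP->//|ji].
have mj' : mark j alpha (above j alpha beta).
  by case: mj => // E'; move: ji; rewrite E' ltNge ia.
have ik := le_lt_trans ia ak.
have [[ja' cj] Ej] := mj'.
have cji : c (above j alpha beta) (above i alpha beta) <= j.
  case: mi => [/mij[[ia' ci] _]|->//]; exact: (subadditive_down sub ji ia' ak).
have [Eb bi' rec] := rb.
have cbi : c beta (above i alpha beta) <= j by apply: le_trans cji; apply/ltW/rec.
have cbj : c beta (above j alpha beta) <= j by exact: (subadditive_down sub bj ji ik).
split=> // x Ex bx xj; rewrite ltNge; apply/negP => cx.
have cxj := le_trans cx cbj.
have : above j alpha beta <= x.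
  apply: jmin => //; left; split=> //; split; first exact: lt_trans ja'.
  exact: (subadditive_trans sub xj ja' ak).
by rewrite leNgt xj.
Qed.

Lemma records_boxminus : boxminus_ind kappa theta.
Proof.
have t0 := regular_gt0 wfO reg_theta.
pose Gamma := [set alpha | alpha < kappa /\ limit_of E alpha].
have accR i alpha x : i < theta -> Gamma alpha -> acc (rung i alpha) x <-> mark i alpha x /\ limit_of E x.
  move=> it [ak la]; have ll := limit_of_limit la.
  rewrite (accP wfO _ (rung_below (i := i) ll)); split=> [[rx lx]|[mx lx]].
    have xa : x < alpha by exact: rung_below rx.
    have [lE [|E']] := (rung_limit it ak la (ltW xa)).1 lx; first by [].
    by move: xa; rewrite E' ltxx.
  have xa : x < alpha by case: mx => -[].
  by split; [left|apply/(rung_limit it ak la (ltW xa)); split=> //; left].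
exists Gamma, (fun=> \bot), (fun alpha i => rung i alpha); split.
- split=> [alpha [[ak cfa] /(acc_belowP wfO)[_ /(single_cf ak)]]//|alpha [ak la]].
  by apply/(acc_belowP wfO); split=> //; exact: limit_of_limit la.
- move=> alpha Ga; have [ak la] := Ga; have Ea := E_closed ak la.
  have ll := limit_of_limit la; have [a0 _] := ll; split=> //.
  + move=> i _ it; apply/(clubP wfO _ a0); split; first exact: rung_below.
      move=> gamma ga /(rung_limit it ak la (ltW ga))[_ [mg|E']]; first by left.
      by move: ga; rewrite E' ltxx.
    by apply/(rung_limit it ak la (lexx _)); split=> //; right.
  + by move=> i j _ ij _; exact: rung_mono.
  + apply/seteqP; split=> [x [[xk lx] xa]|x [i [_ it] /(accR _ _ _ it Ga)[[[xa cx] Ex] lx]]].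
      exists (c x alpha); first by split; [exact: le0x|exact: col].
      apply/accR => //; first exact: col.
      by split=> //; split; [split|exact: E_closed].
    by split=> //; split=> //; exact: lt_trans ak.
- move=> alpha i x Ga _ it /(accR _ _ _ it Ga)[mx lx]; split; first exact: le0x.
  by apply: rung_initial => //; [case: Ga|exact: limit_of_limit lx].
- move=> D Dc; have [Dk Dcl [_ Dl]] := (clubP wfO D (regular_gt0 wfO reg_kappa)).1 Dc.
  have Du x : x < kappa -> exists y, [/\ D y, x < y & y < kappa] by move=> /Dl.
  pose P := [set x | limit_of D x /\ limit_of E x].
  have Pu x : x < kappa -> exists y, [/\ P y, x < y & y < kappa].
    by move=> /(common_limits wfO reg_kappa reg Du E_unb)[y [? ? ? ? ?]]; exists y.
  have [alpha [_ ak _ lP _]] := common_limits wfO reg_kappa reg Pu Pu lt_theta_kappa.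
  have lD : limit_of D alpha by apply/limit_of_limit_of/(limit_of_sub _ lP) => x _ [].
  have lE : limit_of E alpha by apply/limit_of_limit_of/(limit_of_sub _ lP) => x _ [].
  exists alpha; first by split=> //; apply/(accP wfO _ Dk); split=> //; exact: Dcl.
  move=> i _ it DE; apply: (limit_of_infinite wfO lP).
  apply: sub_finite_set (E_finite it (E_closed ak lE)) => x [[lDx lEx] xa].
  have /(rung_limit it ak lE (ltW xa))[_ [//|E']] : limit_of (rung i alpha) x.
    by rewrite -DE limit_of_initial //; exact: ltW.
  by move: xa; rewrite /below /= E' ltxx.
Qed.

End Records.

(** Ladders form a coherent C-sequence without limit points, hence without a
    thread, and walking along them gives a strong coloring [c].  If [reached c]
    misses the limit points of a tail of a club, then those limit points form a
    club that meets each of its sets [Dle c i alpha] in a finite set. *)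
Lemma single_boxminus : boxminus_ind kappa theta.
Proof.
have [c cs] := single_strong; have [col sub cl unb] := cs.
have [often|nt] := pselect (reached_often theta kappa c).
  apply: (boxminus_of_coloring wfO reg_theta reg_kappa lt_theta_kappa col) => //.
  exact: strong_closed_coloring cs.
have [D [xi [Dc xk none]]] : exists D xi, [/\ club D kappa, xi < kappa &
    forall alpha, xi < alpha -> limit_of D alpha -> ~ reached theta kappa c alpha].
  apply: contrapT => h; apply: nt => D Dc xi xk; apply: contrapT => h'; apply: h; exists D, xi.
  by split=> // alpha xa la ra; apply: h'; exists alpha.
have [Dk Dcl [_ Dl]] := (clubP wfO D (regular_gt0 wfO reg_kappa)).1 Dc.
pose E := [set alpha | [/\ alpha < kappa, xi < alpha & limit_of D alpha]].
have E_closed delta : delta < kappa -> limit_of E delta -> E delta.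
  move=> dk lE; split=> //.
    by have [d0 h] := lE; have [x [[_ xx _] _ xd]] := h _ d0; exact: lt_trans xd.
  by apply/limit_of_limit_of/(limit_of_sub _ lE) => x _ [].
apply: (records_boxminus col sub (E := E)) => //.
- by move=> x [].
- move=> x xk'; have mk : Order.max x xi < kappa by rewrite gt_max xk'.
  have [y|y|delta [+ dk _ lD _]] := common_limits wfO reg_kappa reg (A := D) (B := D) _ _ mk.
  + by move=> /Dl.
  + by move=> /Dl.
  by rewrite gt_max => /andP[xd xid]; exists delta.
move=> i alpha it [ak xa lDa]; apply: contrapT => inf.
have [|delta da lim] := infinite_limit wfO (alpha := alpha) inf; first by move=> x [[]].
have lc : limit_of (Dle c i alpha) delta by apply: limit_of_sub lim => x _ [].
move: da; rewrite le_eqVlt => /orP[/eqP E'|da].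
  by apply: (none alpha) => //; split=> //; exists i => //; rewrite -{2}E'.
have dk := lt_trans da ak.
have [_ xd lD] : E delta by apply: E_closed => //; apply: limit_of_sub lim => x _ [].
apply: (none delta) => //; split=> //; exists i => //.
have cd := cl _ _ _ it da ak lc.
apply: limit_of_sub lc => x xd' [xa' cx]; split=> //.
exact: (subadditive_down sub xd' da ak).
Qed.

End Single.

Theorem theoremA (d : Order.disp_t) (O : bOrderType d) (wfO : well_ordered O)
    (theta kappa : O) (reg_theta : infinite_regular theta)
    (reg_kappa : infinite_regular kappa) (lt_theta_kappa : theta < kappa) :
  let P1 := boxminus_ind kappa theta in
  let P2 := exists c : O -> O -> O,
    [/\ witnesses_U kappa (succ (succ \bot)) theta (succ (succ \bot)) c,
        closed_coloring kappa theta c & subadditive kappa c] in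
  let P3 := exists c : O -> O -> O,
    [/\ witnesses_U kappa kappa theta (osup (Reg kappa)) c,
        closed_coloring kappa theta c & subadditive kappa c] in
  [/\ P1 <-> P2, P2 <-> P3 & square kappa theta -> [/\ P1, P2 & P3]].
Proof.
move=> P1 P2 P3.
have strong3 : (exists c, strong theta kappa c) -> P3.
  move=> [c cs]; have [_ sub _ _] := cs; exists c; split=> //.
    exact: strong_witnesses_U.
  exact: strong_closed_coloring cs.
have p32 : P3 -> P2.
  move=> [c [wU cl sub]]; exists c; split=> //.
  apply: witnesses_U_two wU => //.
  have t2 : succ (succ \bot) < theta by do 2!apply: regular_succ => //; exact: regular_gt0 reg_theta.
  apply: le_trans (ltW t2) _; apply: (@le_osup _ _ wfO _ kappa) => // mu [/ltW//].
have p21 : P2 -> P1.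
  move=> [c [wU cl sub]]; have [col _] := wU.
  have [[mu [rm mt]]|none] := pselect (exists mu, Reg kappa mu /\ mu <> theta).
    apply: (boxminus_of_coloring wfO reg_theta reg_kappa lt_theta_kappa col) => //.
      exact: witnesses_U_unbounded wU.
    exact: reached_often_Reg rm mt.
  apply: single_boxminus => // mu rm; apply: contrapT => mt; by apply: none; exists mu.
have p13 : P1 -> P3 by move=> /(boxminus_strong wfO reg_theta reg_kappa)/strong3.
split; [by split=> // /p13/p32|by split=> // /p21/p13|].
move=> /(square_strong wfO reg_theta reg_kappa lt_theta_kappa)/strong3 p3.
by split=> //; [exact/p21/p32|exact: p32].
Qed.
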